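(* Let $\alpha\in\Theta$, let $\varpi_\alpha$ be an extremal low weight of $\pi$ with respect to $\alpha$, and let $\gamma_1,\dots,\gamma_K=\alpha$ be the associated sequence of simple roots. The function $\lambda\mapsto r_{\alpha,\varpi_\alpha}(\lambda)$ on $\mathfrak a_\Theta^*$ is not identically zero if either one of the following conditions is satisfied. (i) $\{\gamma_1,\dots,\gamma_K\}\subset\Theta$. (ii) The connected component of the Dynkin diagram of $\Theta$ containing $\alpha$ is orthogonal to $\bar\pi$; $\Theta\setminus\{\gamma_1,\dots,\gamma_K\}$ is orthogonal to $\{\gamma_1,\dots,\gamma_{K-1}\}$; and moreover the Dynkin diagram of the system $\{\gamma_1,\dots,\gamma_{K-1}\}$ is of type $A_{K-1}$.
   Context: $\mathfrak g$ is a finite-dimensional reductive Lie algebra over $\mathbb C$ and $(\pi,V)$ is a faithful irreducible finite-dimensional representation of $\mathfrak g$. $\langle X,Y\rangle=\operatorname{Trace}\pi(X)\pi(Y)$ on $\mathfrak g$ (non-degenerate). $\mathfrak a$ is a Cartan subalgebra, $\Sigma(\mathfrak g)$ the root system, $\Sigma(\mathfrak g)^+$ a positive system with simple roots $\Psi(\mathfrak g)$, $\rho$ half the sum of positive roots. The form on $\mathfrak a$ identifies $\mathfrak a^*\simeq\mathfrak a$ and gives a form $\langle\ ,\ \rangle$ on $\mathfrak a^*$ (orthogonality refers to it). $\Theta\subsetneq\Psi(\mathfrak g)$ is fixed. $\mathfrak a_\Theta=\{H\in\mathfrak a;\alpha(H)=0\ \forall\alpha\in\Theta\}$; $\mathfrak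 g_\Theta$ is the centralizer of $\mathfrak a_\Theta$ in $\mathfrak g$; $\Sigma(\mathfrak g_\Theta)=\{\alpha\in\Sigma(\mathfrak g);\alpha|_{\mathfrak a_\Theta}=0\}$, $\Sigma(\mathfrak g_\Theta)^+=\Sigma(\mathfrak g_\Theta)\cap\Sigma(\mathfrak g)^+$. For $\lambda\in\mathfrak a_\Theta^*$, $\lambda_\Theta\in\mathfrak a^*$ is the extension of $\lambda$ by $0$ on the orthogonal complement of $\mathfrak a_\Theta$ in $\mathfrak a$. $\mathcal W(\pi)$ is the set of weights of $\pi$, partially ordered by $\varpi\le\varpi'$ iff $\varpi'-\varpi$ is a non-negative integer combination of simple roots; $\bar\pi$ is the lowest weight; $D_\pi(\varpi)=\frac12\langle\bar\pi-\varpi,\bar\pi+\varpi-2\rho\rangle$; $\overline{\mathcal W}_\Theta(\pi)$ is the set of lowest weights (w.r.t. $\Sigma(\mathfrak g_\Theta)^+$) of the irreducible components of $\pi|_{\mathfrak g_\Theta}$. For $\varpi\in\mathfrak a^*$, $\varpi|_{\mathfrak a_\Theta}$ is regarded as a linear function on $\mathfrak a_\Theta^*$ by $\varpi|_{\mathfrak a_\Theta}(\lambda)=\langle\lambda_\Theta,\varpi\rangle$. $\Omega_{\pi,\Theta}=\{(\varpi|_{\mathfrak a_\Theta},D_\pi(\varpi));\varpi\in\overline{\mathcal W}_\Theta(\pi)\}$. For $\alpha\in\Psi(\mathfrak g)$, an extremal low weight of $\pi$ with respect to $\alpha$ is a minimal element (for $\le$) of $\{\varpi\in\mathcal W(\pi);\langle\varpi,\alpha\rangle\ne0\}$.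 Given such $\varpi_\alpha$, the set $\{\varpi\in\mathcal W(\pi);\varpi\le\varpi_\alpha\}$ is totally ordered; write it $\{\varpi_1<\cdots<\varpi_K\}$ (so $\varpi_1=\bar\pi$, $\varpi_K=\varpi_\alpha$). The differences $\gamma_\nu=\varpi_{\nu+1}-\varpi_\nu$ ($1\le\nu<K$) are simple roots; with $\gamma_K=\alpha$ this is the associated sequence $\gamma_1,\dots,\gamma_K$. For $\alpha\in\Theta$ put $\varpi'_\alpha=\varpi_\alpha+\alpha\in\mathcal W(\pi)$ and define $0=n_0<n_1<\cdots<n_L<K$ by $\{\varpi_{n_0+1},\dots,\varpi_{n_L+1}\}=\{\varpi\in\overline{\mathcal W}_\Theta(\pi);\varpi\le\varpi_\alpha\}$. Put $\Omega^{\varpi_\alpha}_{\pi,\Theta}=\{(\varpi|_{\mathfrak a_\Theta},D_\pi(\varpi));\varpi\in\overline{\mathcal W}_\Theta(\pi),\varpi\le\varpi_\alpha\}$ and $$r_{\alpha,\varpi_\alpha}(\lambda)=\prod_{(\mu,C)\in\Omega_{\pi,\Theta}\setminus\Omega^{\varpi_\alpha}_{\pi,\Theta}}\bigl(\langle\lambda_\Theta,\varpi'_\alpha\rangle-\mu(\lambda)+D_\pi(\varpi'_\alpha)-C\bigr)\cdot\prod_{i=1}^L\bigl(\langle\lambda_\Theta,\varpi_\alpha-\varpi_{n_i}\rangle-\langle\alpha,\varpi_\alpha\rangle+D_\pi(\varpi_\alpha)-D_\pi(\varpi_{n_i+1})\bigr).$$ *)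

(* Defs.v *)
From HB Require Import structures.
From mathcomp Require Import all_boot all_order all_algebra.
From mathcomp Require Import finmap.
From mathcomp Require Import boolp classical_sets functions cardinality fsbigop.
From mathcomp Require Import reals.
From mathcomp Require Import complex.

Set Implicit Arguments.
Unset Strict Implicit.
Unset Printing Implicit Defensive.

Import GRing.Theory.

Local Open Scope ring_scope.
Local Open Scope classical_set_scope.

HB.mixin Record Vector_isLieAlgebra (F : fieldType) (g : Type)
    of Vector F g := {
  lieb : g -> g -> g;
  lieb_linearl : forall y, linear (fun x => lieb x y);
  lieb_linearr : forall x, linear (lieb x);
  liebb : forall x, lieb x x = 0;
  lieb_jacobi : forall x y z,
    lieb x (lieb y z) + lieb y (lieb z x) + lieb z (lieb x y) = 0
}.

#[short(type="lieAlgType")]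
HB.structure Definition LieAlgebra (F : fieldType) :=
  {g of Vector_isLieAlgebra F g & Vector F g}.

Section LieTheory.
Variables (F : fieldType) (g : lieAlgType F).

Definition lie_ideal (I : {vspace g}) :=
  forall x y, y \in I -> lieb x y \in I.

Definition lie_derived (U : {vspace g}) : {vspace g} :=
  <<[seq lieb x y | x <- vbasis U, y <- vbasis U]>>%VS.

Definition lie_solvable (U : {vspace g}) :=
  exists k, iter k lie_derived U = 0%VS.

(* The radical is contained in (hence equal to) the centre. *)
Definition reductive :=
  forall I : {vspace g}, lie_ideal I -> lie_solvable I ->
  forall x y, x \in I -> lieb x y = 0.

Definition ad_semisimple (H : g) :=
  exists2 e : seq g, basis_of fullv e &
  forall x, x \in e -> exists c : F, lieb H x = c *: x.

(* Cartan subalgebras of a reductive Lie algebra: maximal abelian subalgebras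
   consisting of semisimple elements (an element commuting with an abelian
   subalgebra spans with it an abelian subalgebra). *)
Definition cartan_subalgebra (a : {vspace g}) :=
  [/\ forall x y, x \in a -> y \in a -> lieb x y = 0,
      forall x, (forall y, y \in a -> lieb x y = 0) -> x \in a &
      forall H, H \in a -> ad_semisimple H].

Variable V : vectType F.

Definition lie_representation (pi : 'Hom(g, 'End(V))) :=
  forall x y, pi (lieb x y) = (pi x \o pi y)%VF - (pi y \o pi x)%VF.

Definition faithful (pi : 'Hom(g, 'End(V))) := injective pi.

Definition stable (pi : 'Hom(g, 'End(V))) (S : set g) (U : {vspace V}) :=
  forall x v, S x -> v \in U -> pi x v \in U.

Definition irreducible (pi : 'Hom(g, 'End(V))) (S : set g) (U : {vspace V}) :=
  [/\ U != 0%VS, stable pi S U &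
      forall W : {vspace V}, (W <= U)%VS -> stable pi S W ->
        W = 0%VS \/ W = U].

Definition lfun_trace (f : 'End(V)) : F :=
  \tr (passmx.mxof (vbasis fullv) (vbasis fullv) f).

End LieTheory.

Section Weights.
Variables (F : fieldType) (g : lieAlgType F).

Definition dual (W : vectType F) := 'Hom(W, F^o).

Variable a : {vspace g}.
Notation ha := (subvs_of a).

Definition root_vector (beta : dual ha) (X : g) :=
  forall H : ha, lieb (vsval H) X = (beta H : F) *: X.

Definition roots : set (dual ha) :=
  [set beta | beta != 0 /\ exists2 X, X != 0 & root_vector beta X].

Definition wle (Psi : {fset dual ha}) (x y : dual ha) :=
  exists c : dual ha -> nat, y - x = \sum_(beta <- Psi) beta *+ c beta.

Definition simple_system (Psi : {fset dual ha}) :=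
  [/\ free Psi, forall beta, beta \in Psi -> roots beta &
      forall beta, roots beta -> wle Psi 0 beta \/ wle Psi beta 0].

Definition positive_roots (Psi : {fset dual ha}) : set (dual ha) :=
  [set beta | roots beta /\ wle Psi 0 beta].

Variables (V : vectType F) (pi : 'Hom(g, 'End(V))).

Definition weight_vector (mu : dual ha) (v : V) :=
  forall H : ha, pi (vsval H) v = (mu H : F) *: v.

Definition weights : set (dual ha) :=
  [set mu | exists2 v, v != 0 & weight_vector mu v].

Definition lowest_weight (P : set (dual ha)) (U : {vspace V}) (mu : dual ha) :=
  exists v, [/\ v \in U, v != 0, weight_vector mu v &
    forall beta X, P beta -> root_vector (- beta) X -> pi X v = 0].

Definition trace_form (x y : g) : F := lfun_trace (pi x \o pi y)%VF.

(* linfun is meaningful here since trace_form is bilinear *)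
Definition flat (H : ha) : dual ha :=
  linfun (fun H' : ha => trace_form (vsval H) (vsval H') : F^o).

(* flat is linear, and bijective when the form is non-degenerate *)
Definition sharp (mu : dual ha) : ha := ((linfun flat)^-1)%VF mu.

Definition dform (mu nu : dual ha) : F :=
  trace_form (vsval (sharp mu)) (vsval (sharp nu)).

Definition orthoa (U : {vspace ha}) : {vspace ha} :=
  (\bigcap_(H <- vbasis U) lker (flat H))%VS.

End Weights.

Section Theta.
Variables (F : fieldType) (g : lieAlgType F) (a : {vspace g}).
Variables (V : vectType F) (pi : 'Hom(g, 'End(V))).
Notation ha := (subvs_of a).
Variables (Psi Theta : {fset dual ha}).
Notation "'[ x , y ]" := (dform pi x y) (at level 0, format "''[' x ,  y ]").

Definition a_Theta : {vspace ha} :=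
  (\bigcap_(beta <- enum_fset Theta) lker beta)%VS.

Definition g_Theta : set g :=
  [set X | forall H : ha, H \in a_Theta -> lieb (vsval H) X = 0].

Definition positive_roots_Theta : set (dual ha) :=
  [set beta | positive_roots Psi beta /\
              forall H, H \in a_Theta -> beta H = 0].

Definition dual_Theta := dual (subvs_of a_Theta).

(* Extension by 0 on the orthogonal complement: daddv_pi U U' is the
   projection onto U along U'. *)
Definition ext_Theta (lambda : dual_Theta) : dual ha :=
  (lambda \o linfun (vsproj a_Theta)
          \o daddv_pi a_Theta (orthoa pi a_Theta))%VF.

(* mu|_{a_Theta} as a linear function on the dual of a_Theta *)
Definition res_Theta (mu : dual ha) : dual dual_Theta :=
  linfun (fun lambda : dual_Theta => '[ext_Theta lambda, mu] : F^o).

Definition rho : dual ha :=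
  2%:R^-1 *: \sum_(beta \in positive_roots Psi) beta.

(* Lowest weights of the irreducible components of V restricted to g_Theta,
   i.e. of its simple g_Theta-submodules. *)
Definition lowest_weights_Theta : set (dual ha) :=
  [set mu | exists2 U : {vspace V}, irreducible pi g_Theta U &
            lowest_weight pi positive_roots_Theta U mu].

Definition extremal_low_weight (alpha mu : dual ha) :=
  let S := [set nu | weights pi nu /\ '[nu, alpha] != 0] in
  S mu /\ forall nu, S nu -> wle Psi nu mu -> nu = mu.

Variable lowpi : dual ha.

Definition D_pi (mu : dual ha) : F :=
  2%:R^-1 * '[lowpi - mu, lowpi + mu - rho *+ 2].

Definition Omega : set (dual dual_Theta * F) :=
  [set (res_Theta mu, D_pi mu) | mu in lowest_weights_Theta].

Definition Omega_below (walpha : dual ha) : set (dual dual_Theta * F) :=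
  [set (res_Theta mu, D_pi mu) |
    mu in [set mu | lowest_weights_Theta mu /\ wle Psi mu walpha]].

(* w = [:: w_1; ...; w_K] is numbered from 1, n = [:: n_0; ...; n_L] from 0 *)
Definition wt (w : seq (dual ha)) (nu : nat) : dual ha := nth 0 w nu.-1.

Definition weight_chain (walpha : dual ha) (w : seq (dual ha)) :=
  (forall i j, (1 <= i < j)%N -> (j <= size w)%N ->
     wle Psi (wt w i) (wt w j) /\ wt w i != wt w j) /\
  [set` w] = [set mu | weights pi mu /\ wle Psi mu walpha].

(* gamma_1, ..., gamma_(K-1) *)
Definition gammas' (w : seq (dual ha)) : seq (dual ha) :=
  [seq wt w nu.+1 - wt w nu | nu <- iota 1 (size w).-1].

(* gamma_1, ..., gamma_K *)
Definition gammas (alpha : dual ha) (w : seq (dual ha)) : seq (dual ha) :=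
  rcons (gammas' w) alpha.

Definition chain_indices (walpha : dual ha) (w : seq (dual ha)) (n : seq nat) :=
  [/\ ohead n = Some 0%N, sorted ltn n, all (fun k => (k < size w)%N) n &
      [set` [seq wt w k.+1 | k <- n]] =
      [set mu | lowest_weights_Theta mu /\ wle Psi mu walpha]].

Definition r_fun (alpha walpha : dual ha) (w : seq (dual ha)) (n : seq nat)
    (lambda : dual_Theta) : F :=
  let lam := ext_Theta lambda in
  let walpha' := walpha + alpha in
  (\big[*%R/1]_(p \in Omega `\` Omega_below walpha)
     ('[lam, walpha'] - p.1 lambda + D_pi walpha' - p.2)) *
  \prod_(1 <= i < size n)
     ('[lam, walpha - wt w (nth 0%N n i)] - '[alpha, walpha]
      + D_pi walpha - D_pi (wt w (nth 0%N n i).+1)).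

Definition dynkin_adj : rel (dual ha) :=
  [rel x y | (x != y) && ('[x, y] != 0)].

Definition dynkin_component (S : {fset dual ha}) (x : S) : set (dual ha) :=
  [set val y | y in [set y : S |
    connect (fun u v : S => dynkin_adj (val u) (val v)) x y]].

(* The Dynkin diagram of the set of elements of s is of type A_k (empty for
   k = 0): they can be numbered so that the Cartan matrix is the one of A_k. *)
Definition dynkin_type_A (k : nat) (s : seq (dual ha)) :=
  exists t : seq (dual ha), [/\ uniq t, size t = k, t =i s &
    forall i j, (i < k)%N -> (j < k)%N ->
      2%:R * '[nth 0 t i, nth 0 t j] / '[nth 0 t j, nth 0 t j] =
      if i == j then 2%:R
      else if (i == j.+1) || (j == i.+1) then -1 else 0].

End Theta.

(* Main.v *)
From HB Require Import structures.
Require Import Defs.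
From mathcomp Require Import all_boot all_order all_algebra.
From mathcomp Require Import finmap.
From mathcomp Require Import boolp classical_sets functions cardinality fsbigop.
From mathcomp Require Import reals complex.
From mathcomp Require Import ring.

Set Implicit Arguments.
Unset Strict Implicit.
Unset Printing Implicit Defensive.

Import GRing.Theory Num.Theory Order.TTheory.

Local Open Scope ring_scope.
Local Open Scope classical_set_scope.

Local Notation roots := Defs.roots.

(** Why the product does not vanish identically. Every factor of [r] is an affine
    function of [lambda], and finitely many non-zero affine functions have a
    common non-zero ([affine_common_nonzero]). So it is enough that the linear
    part of each factor is not 0. This linear part is
    [lambda |-> (lambda_Theta, nu)] for a combination [nu] of simple roots, and it
    is not 0 as soon as some simple root outside [Theta] has a non-zero
    coefficient in [nu], because the corresponding coweight lies in [a_Theta]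
    ([res_Theta_coef]).

    In the second product [nu] is the difference between [walpha] and the weight
    of the chain just before a weight [x k] that is a lowest weight of a
    component of [V] under [g_Theta]. A lowest vector of weight [x k] can only be
    lowered by the step [gam k.-1] of the chain, so this step is not in [Theta]
    ([lowest_chain_step]), and its coefficient in [nu] is 1.

    In the first product [nu] is [walpha + alpha - mu], with [mu] the weight of a
    lowest weight vector [v] for [g_Theta]. If the linear part vanishes, then
    [mu] and [walpha + alpha] have the same coefficients outside [Theta], and one
    has to see that [mu] is below [walpha], so that its pair is not an index of
    the product. In case (i), [mu - lowpi] is a combination of [Theta], nothing
    lowers [v], and [mu = lowpi] ([chain_inside_level]). In case (ii), [v] is
    lowered by some [gam m] outside [Theta]. The support of a weight minus
    [lowpi] has no component orthogonal to [lowpi] ([support_connected]);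
    applied after lowering by [gam m], this shows that [gam m.+1], [gam m.+2],
    ... do not occur in [mu - lowpi] ([coef0_above]), and that [gam m] alone
    lowers [v]. Using the Serre relations of type A one sees that from there on
    only [gam m.-1], ..., [gam 0] in turn can lower, which gives
    [mu = lowpi + gam 0 + ... + gam m] ([type_A_level_below]), a member of the
    chain.

    The arguments on the chain itself rest on one property of the sequence of
    simple roots: each [x i] is an extremal low weight for [gam i]
    ([gam_extremal]), so that these roots are distinct and form a path in the
    Dynkin diagram, of which only [gam 0] is not orthogonal to [lowpi].

    What precedes is the structure theory of the pair [(g, V)]. Root strings
    come from a computation with sl2-triples ([sl2_iterF_inj]). The trace form
    is non-degenerate because a root vector in its radical kills the lowest
    weight vector ([in_radical_kills_lowest]), and positive definite on the real
    span of the roots because it is a sum of squares of weights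
    ([trace_weights]). *)

(** * Subspaces, joint eigenvectors and diagonalizable operators *)

Section LinearAlgebra.
Variables (F : fieldType) (W : vectType F).
Implicit Types (P : W -> Prop) (U : {vspace W}) (x y : W).

Definition subspace_pred P :=
  [/\ P 0, forall x y, P x -> P y -> P (x + y) &
      forall (c : F) x, P x -> P (c *: x)].

(** Subspaces are often given by a condition that is not decidable; a subspace of
    maximal dimension among those on which the condition holds is the set of all
    its solutions. *)
Lemma vspace_of_pred P :
  subspace_pred P -> exists U, forall x, P x <-> x \in U.
Proof.
move=> [P0 PD PZ].
pose Q n := `[< exists U, (forall x, x \in U -> P x) /\ \dim U = n >].
have exQ : exists n, Q n.
  exists 0%N; apply/asboolP; exists 0%VS; rewrite dimv0; split=> // x.
  by rewrite memv0 => /eqP->.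
have bQ n : Q n -> (n <= \dim {:W})%N.
  by move=> /asboolP[U [_ <-]]; apply/dimvS/subvf.
case: (ex_maxnP exQ bQ) => n /asboolP[U [UP dU]] maxn.
exists U => x; split=> [Px|/UP//].
case: (boolP (x \in U)) => // xU.
have : Q (\dim (U + <[x]>)%VS).
  apply/asboolP; exists (U + <[x]>)%VS; split=> // y.
  move=> /memv_addP[u /UP Pu [v /vlineP[k ->] ->]].
  by apply: PD => //; apply: PZ.
move/maxn; rewrite -dU => le_dim.
have /eqP eqU : U == (U + <[x]>)%VS by rewrite eqEdim addvSl.
by move: xU; rewrite eqU (subvP (addvSr U _)) ?memv_line.
Qed.

Definition inspan P x :=
  exists2 s : seq W, (forall y, y \in s -> P y) & x \in <<s>>%VS.

Lemma subspace_inspan P : subspace_pred (inspan P).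
Proof.
split; first by exists [::]; rewrite ?mem0v.
- move=> x y [s sP xs] [t tP yt]; exists (s ++ t).
    by move=> z; rewrite mem_cat => /orP[/sP|/tP].
  by rewrite span_cat memv_add.
- by move=> c x [s sP xs]; exists s; rewrite ?memvZ.
Qed.

Definition sspan P : {vspace W} :=
  sval (cid (vspace_of_pred (subspace_inspan P))).

Lemma sspanP P x : inspan P x <-> x \in sspan P.
Proof. by rewrite /sspan; case: cid => U /= UP. Qed.

Lemma mem_sspan P x : P x -> x \in sspan P.
Proof.
move=> Px; apply/sspanP; exists [:: x]; last by rewrite memv_span ?mem_head.
by move=> y; rewrite inE => /eqP->.
Qed.

Lemma sspan_min P U : (forall x, P x -> x \in U) -> (sspan P <= U)%VS.
Proof.
move=> PU; apply/subvP => x /sspanP[s sP]; apply/subvP.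
by apply/span_subvP => y /sP/PU.
Qed.

Lemma sspan_sub P U x : x \in sspan P -> (forall y, P y -> y \in U) -> x \in U.
Proof. by move=> xP /sspan_min/subvP; apply. Qed.

Lemma span_stable (f : 'End(W)) (s : seq W) :
  (forall y, y \in s -> f y \in <<s>>%VS) ->
  forall x, x \in <<s>>%VS -> f x \in <<s>>%VS.
Proof.
move=> sf x xs; have: (<<s>> <= f @^-1: <<s>>)%VS.
  by apply/span_subvP => y /sf; rewrite memv_preim.
by move/subvP/(_ x xs); rewrite memv_preim.
Qed.

Section JointEigen.
Variables (X : Type) (T : X -> 'End(W)).

(** Applying [T h - mu h] with [mu h != nu h] removes the vectors of character
    [mu] from a combination equal to [u] and only rescales [u]; so if no
    spanning vector had character [nu] nothing would remain. *)
Lemma joint_eigen_indep (P : (X -> F) -> Prop) (nu : X -> F) (s : seq W) u :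
  (forall y, y \in s -> exists2 mu, P mu & forall h, T h y = mu h *: y) ->
  u \in <<s>>%VS -> (forall h, T h u = nu h *: u) -> u != 0 ->
  exists2 mu, P mu & mu =1 nu.
Proof.
move=> sP + nuu u0; elim: s sP => [|x s IHs] sP.
  by rewrite span_nil memv0 (negPf u0).
have [mu Pmu mux] := sP x (mem_head _ _).
case: (pselect (mu =1 nu)) => [eq_mu _|/existsNP[h /eqP hP]];
  first by exists mu.
have sP' y (ys : y \in s) := sP y (@mem_behead _ (x :: s) y ys).
rewrite span_cons => /memv_addP[_ /vlineP[k ->] [v vs def_u]].
apply: IHs => //.
have Tv : T h v \in <<s>>%VS.
  apply: span_stable vs => y ys; have [mu' _ ->] := sP' y ys.
  by rewrite memvZ ?memv_span.
have : (nu h - mu h) *: u \in <<s>>%VS.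
  have -> : (nu h - mu h) *: u = T h v - mu h *: v.
    rewrite scalerBl -nuu def_u linearD linearZ /= mux !scalerDr !scalerA.
    by rewrite [k * _]mulrC opprD addrACA subrr add0r.
  by rewrite memvB ?memvZ.
by move/(memvZ (nu h - mu h)^-1);
  rewrite scalerA mulVf ?scale1r ?subr_eq0 1?eq_sym.
Qed.
End JointEigen.

Section Diagonalizable.
Variable T : 'End(W).

(** The value at [T] of the polynomial with roots [cs], applied to [x]. *)
Definition eval_roots (cs : seq F) x := foldr (fun c y => T y - c *: y) x cs.

Lemma eval_rootsB cs (k : F) x y :
  eval_roots cs (x - k *: y) = eval_roots cs x - k *: eval_roots cs y.
Proof.
elim: cs => //= c cs ->; rewrite linearB linearZ /= !scalerBr !scalerA.
by rewrite [c * k]mulrC !opprB addrACA [RHS]addrACA; congr (_ + _);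
  rewrite addrC.
Qed.

Lemma eval_roots_eigen cs d x :
  T x = d *: x -> eval_roots cs x = (\prod_(c <- cs) (d - c)) *: x.
Proof.
move=> Tx; elim: cs => [|c cs /= ->]; first by rewrite big_nil scale1r.
by rewrite big_cons linearZ /= Tx !scalerA -scalerBl mulrBl [d * _]mulrC.
Qed.

Lemma eval_roots_stable (U : {vspace W}) cs x :
  (forall y, y \in U -> T y \in U) -> x \in U -> eval_roots cs x \in U.
Proof. by move=> sU xU; elim: cs => //= c cs IH; rewrite memvB ?memvZ ?sU. Qed.

(** If [c] is not in [cs], dividing by the value at [c] of the polynomial with
    roots [cs] splits off the component of [x] of eigenvalue [c] inside every
    stable subspace. *)
Lemma eigen_split (U : {vspace W}) cs x :
  (forall y, y \in U -> T y \in U) -> uniq cs -> x \in U ->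
  eval_roots cs x = 0 ->
  x \in sspan (fun z => z \in U /\ exists c, T z = c *: z).
Proof.
move=> sU; elim: cs x => [|c cs IH] x /=; first by move=> _ _ ->; rewrite mem0v.
move=> /andP[ccs ucs] xU; set z := eval_roots cs x => /eqP.
rewrite subr_eq0 => /eqP Tz.
have zU : z \in U by apply: eval_roots_stable.
have zS : z \in sspan (fun z => z \in U /\ exists c, T z = c *: z).
  by apply: mem_sspan; split=> //; exists c.
set q := \prod_(d <- cs) (c - d).
have q0 : q != 0.
  rewrite prodf_seq_neq0; apply/allP => /= d dcs; rewrite subr_eq0.
  by apply: contraNneq ccs => ->.
have : x - q^-1 *: z \in sspan (fun z => z \in U /\ exists c, T z = c *: z).
  apply: IH => //; first by rewrite memvB ?memvZ.
  by rewrite eval_rootsB (eval_roots_eigen _ Tz) -/z scalerA mulVf ?scale1r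
    ?subrr.
by move/memvD/(_ (memvZ (q^-1) zS)); rewrite subrK.
Qed.

(** A stable subspace of a diagonalizable operator is spanned by the eigenvectors
    it contains. *)
Lemma diagonalizable_split (U : {vspace W}) (e : seq W) x :
  (forall y, y \in U -> T y \in U) -> basis_of fullv e ->
  (forall y, y \in e -> exists c, T y = c *: y) -> x \in U ->
  x \in sspan (fun z => z \in U /\ exists c, T z = c *: z).
Proof.
move=> sU be ee xU.
pose ev y : F := xget 0 [set c | T y = c *: y].
have evP y : y \in e -> T y = ev y *: y.
  by move=> /ee[c Tc]; rewrite /ev; case: xgetP => [d -> //|/(_ c)].
apply: (@eigen_split _ (undup [seq ev y | y <- e])) => //;
  first exact: undup_uniq.
have : x \in <<e>>%VS by rewrite (span_basis be) memvf.
move: (undup _) (mem_undup [seq ev y | y <- e]) => cs csE.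
move=> /(coord_span (X := in_tuple e)) ->.
have ze (y : W) : y \in e -> eval_roots cs y = 0.
  move=> ye; rewrite (eval_roots_eigen _ (evP y ye)).
  have : ev y \in cs by rewrite csE map_f.
  move=> /(perm_to_rem) /(perm_big _) ->; rewrite big_cons /=.
  by rewrite subrr mul0r scale0r.
have e0 : eval_roots cs 0 = 0.
  by rewrite -[0 in LHS](subrr 0) -[in X in _ - X](scale1r 0) eval_rootsB
    scale1r subrr.
have eD (k : F) a b : eval_roots cs a = 0 -> eval_roots cs b = 0 ->
  eval_roots cs (k *: a + b) = 0.
  move=> a0 b0; rewrite addrC -[k]opprK scaleNr eval_rootsB a0 b0 scaler0 subrr
    //.
elim/big_rec: _ => // i v _ IH; apply: eD => //; apply/ze/mem_nth/ltn_ord.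
Qed.
End Diagonalizable.

(** Eigenvectors of distinct eigenvalues are independent, so an infinite sequence
    of them cannot exist in finite dimension; this is how raising and lowering
    operators are seen to be nilpotent. *)
Lemma eigen_seq_vanishes (T : 'End(W)) (u : nat -> W) (c d : F) :
  [pchar F] =i pred0 -> d != 0 ->
  (forall k, T (u k) = (c + k%:R * d) *: u k) -> exists k, u k = 0.
Proof.
move=> ch0 d0 Tu; apply: contrapT => /forallNP nz.
have fr n : free [seq u k | k <- rev (iota 0 n)].
  elim: n => [|n IHn]; first exact: nil_free.
  rewrite -[n.+1]addn1 iotaD rev_cat /= free_cons IHn andbT.
  apply/negP; set s := map _ _ => us.
  have [||mu [k kn muE] /(_ tt)] :=
    @joint_eigen_indep unit (fun=> T) (fun mu =>
      exists2 k, (k < n)%N & mu tt = c + k%:R * d)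
     (fun=> c + n%:R * d) s (u n) _ us (fun=> Tu n) _.
  - move=> y /mapP[k]; rewrite mem_rev mem_iota /= add0n => kn ->.
    by exists (fun=> c + k%:R * d); [exists k|move=> _; rewrite Tu].
  - by apply/eqP/nz.
  rewrite muE => /addrI/(mulIf d0)/eqP;
    rewrite eq_sym -subr_eq0 -natrB 1?ltnW //.
  by have /pcharf0P-> := ch0; rewrite subn_eq0 leqNgt kn.
have : (\dim <<[seq u k | k <- rev (iota 0 (\dim {:W}).+1)]>> <= \dim {:W})%N.
  exact/dimvS/subvf.
by have := fr (\dim {:W}).+1;
  rewrite /free size_map size_rev size_iota => /eqP->; rewrite ltnn.
Qed.
End LinearAlgebra.

Section LinearMaps.
Variables (F : fieldType).

Lemma linfunE (U V : vectType F) (f : U -> V) : linear f -> linfun f =1 f.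
Proof.
move=> lf; pose f' := GRing.isSemilinear.Build F U V _ f
  (GRing.semilinear_linear lf).
by pose g : {linear U -> V} := HB.pack f f'; exact: (lfunE g).
Qed.

(** Induction on [X]: if [x] does not vanish on the common kernel of the others,
    take [k] there with [x k != 0] and correct [e] by a multiple of [x] so that
    it vanishes on that kernel. *)
Lemma mem_span_of_kernel (W : vectType F) (X : seq 'Hom(W, F^o))
    (e : 'Hom(W, F^o)) :
  (forall h, (forall x, x \in X -> x h = 0) -> e h = 0) -> e \in <<X>>%VS.
Proof.
elim: X e => [|x X IH] e eX.
  rewrite span_nil memv0; apply/eqP/lfunP => h.
  by rewrite zero_lfunE eX.
have [xK|/existsNP[k /not_implyP[kX /eqP xk]]] :=
  pselect (forall h, (forall y, y \in X -> y h = 0) -> x h = 0).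
  rewrite span_cons (subvP (addvSr _ _)) // IH // => h hX.
  by apply: eX => y; rewrite inE => /predU1P[->|/hX//]; apply: xK.
rewrite span_cons -[e](subrK ((e k / x k : F) *: x)) addrC memv_add //.
  by rewrite memvZ ?memv_line.
apply: IH => h hX; rewrite add_lfunE opp_lfunE scale_lfunE.
have : e (h - (x h / x k : F) *: k) = 0.
  apply: eX => y; rewrite inE => /predU1P[->|yX]; rewrite linearB linearZ /=.
    by rewrite /GRing.scale /= divfK // subrr.
  by rewrite (hX y yX) (kX y yX) scaler0 subrr.
rewrite linearB linearZ /= /GRing.scale /= => /eqP; rewrite subr_eq0 => /eqP->.
apply/eqP; rewrite subr_eq0; apply/eqP.
by rewrite mulrAC -[in RHS]mulrA [_^-1 * _]mulrC mulrA [e k * _]mulrC.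
Qed.

Lemma mem_bigcap_lker (W : vectType F) (T : Type) (s : seq T)
    (f : T -> 'Hom(W, F^o)) (h : W) :
  reflect (forall i, (i < size s)%N -> forall t0, f (nth t0 s i) h = 0)
          (h \in (\bigcap_(t <- s) lker (f t))%VS).
Proof.
apply: (iffP idP).
  elim: s => [_ i //|t s IH];
    rewrite big_cons memv_cap memv_ker => /andP[/eqP fh /IH sh].
  by case=> [|i] //= ilt t0; apply: sh.
elim: s => [_|t s IH kh]; first by rewrite big_nil memvf.
rewrite big_cons memv_cap memv_ker (kh 0%N isT t) eqxx /=.
by apply: IH => i ilt t0; apply: (kh i.+1 ilt t0).
Qed.

Lemma dim_bigcap_lker (W : vectType F) (T : Type) (s : seq T)
    (f : T -> 'Hom(W, F^o)) :
  (\dim {:W} <= \dim (\bigcap_(t <- s) lker (f t)) + size s)%N.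
Proof.
elim: s => [|t s IH]; first by rewrite big_nil addn0.
rewrite big_cons capvC /= addnS -addSn; apply: leq_trans IH _;
  rewrite leq_add2r.
rewrite -(limg_ker_dim (f t)) -addn1 leq_add2l.
by apply: leq_trans (dimvS (subvf _)) _; rewrite dimvf.
Qed.

End LinearMaps.

(** * Eigenvalues of triples with the sl2 commutation relations *)

(** The scalar [d] is 2 for an sl2-triple. Other values, including 0, are needed
    to study [[X, Y]] for opposite root vectors before the trace form is known to
    be non-degenerate, hence before these brackets are known to be coroots. *)
Section LinearTriple.
Variables (C : numFieldType) (W : vectType C) (E F H : 'End(W)) (d : C).
Hypothesis commEF : forall x, E (F x) = F (E x) + H x.
Hypothesis commHE : forall x, H (E x) = E (H x) + d *: E x.
Hypothesis commHF : forall x, H (F x) = F (H x) - d *: F x.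

Lemma iter_lfunP (f : 'End(W)) k (b : C) x y :
  iter k f (b *: x + y) = b *: iter k f x + iter k f y.
Proof. by elim: k => //= k ->; rewrite linearP. Qed.

Lemma iter_raise k c u : H u = c *: u ->
  H (iter k E u) = (c + k%:R * d) *: iter k E u.
Proof.
move=> Hu; elim: k => [|k IH] /=; first by rewrite mul0r addr0.
by rewrite commHE IH linearZ /= -scalerDl -natr1; congr (_ *: _); ring.
Qed.

Lemma iter_lower k c u : H u = c *: u ->
  H (iter k F u) = (c - k%:R * d) *: iter k F u.
Proof.
move=> Hu; elim: k => [|k IH] /=; first by rewrite mul0r subr0.
by rewrite commHF IH linearZ /= -scalerBl -natr1; congr (_ *: _); ring.
Qed.

Lemma lower_iter_raise k c kap u : H u = c *: u -> E (F u) = kap *: u ->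
  F (iter k.+1 E u) = (kap - \sum_(i < k.+1) (c + i%:R * d)) *: iter k E u.
Proof.
move=> Hu EFu; have FE x : F (E x) = E (F x) - H x by rewrite commEF addrK.
elim: k => [|k IH].
  by rewrite /= FE EFu Hu big_ord_recr big_ord0 /= mul0r addr0 add0r scalerBl.
rewrite iterS FE IH linearZ /= -/(iter k.+1 E u) (iter_raise _ Hu) -scalerBl.
by congr (_ *: _); rewrite [in RHS]big_ord_recr /=; ring.
Qed.

Lemma sum_arith n (c : C) :
  2%:R * (\sum_(i < n.+1) (c + i%:R * d)) = n.+1%:R * (2%:R * c + n%:R * d).
Proof.
elim: n => [|n IH]; first by rewrite big_ord_recr big_ord0 /=; ring.
by rewrite big_ord_recr /= mulrDr IH -!natr1; ring.
Qed.

(** The last non-zero vector of the string [E^k u] is killed by [F E], which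
    acts on [E^k u] by [kap - sum_(i <= k) (c + i d)]. *)
Lemma raise_vanishes c kap u : H u = c *: u -> E (F u) = kap *: u -> u != 0 ->
  (exists k, iter k E u = 0) -> exists k, kap = \sum_(i < k.+1) (c + i%:R * d).
Proof.
move=> Hu EFu u0 [k]; elim: k => [/eqP|k IH]; first by rewrite (negPf u0).
have [/IH//|nz] := eqVneq (iter k E u) 0; move=> Eu0; exists k.
apply/eqP; rewrite -subr_eq0; apply/eqP.
have := lower_iter_raise k Hu EFu; rewrite Eu0 linear0 => /esym/eqP.
by rewrite scaler_eq0 (negPf nz) orbF => /eqP.
Qed.

(** The sum in [raise_vanishes] is an arithmetic progression, and [kap = 0]. *)
Lemma primitive_eigenvalue c u : H u = c *: u -> F u = 0 -> u != 0 ->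
  (exists k, iter k E u = 0) -> exists k, 2%:R * c = - (k%:R * d).
Proof.
move=> Hu Fu u0 /(@raise_vanishes c 0 u Hu) [||k k0] //;
  first by rewrite Fu linear0 scale0r.
exists k; have := sum_arith k c; rewrite -k0 mulr0 => /esym/eqP.
by rewrite mulf_eq0 pnatr_eq0 /= addr_eq0 => /eqP.
Qed.

Variable Q : W -> Prop.
Hypothesis QF : forall x, Q x -> Q (F x).
Hypothesis nilE : forall x, Q x -> exists k, iter k E x = 0.
Hypothesis nilF : forall x, Q x -> exists k, iter k F x = 0.

(** Lower [u] as far as possible and apply [primitive_eigenvalue]. The predicate
    [Q] stands for being a weight vector. *)
Lemma half_integral_eigenvalue c u : Q u -> H u = c *: u -> u != 0 ->
  exists j k, 2%:R * c = (j.*2%:R - k%:R) * d.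
Proof.
move=> Qu Hu u0; have [n] := nilF Qu; elim: n => [/eqP|n IH].
  by rewrite (negPf u0).
have [/IH//|nz] := eqVneq (iter n F u) 0; move=> Fu0.
have QFu : Q (iter n F u) by elim: (n) => //= m; apply: QF.
have [k ck] := primitive_eigenvalue (iter_lower n Hu) Fu0 nz (nilE QFu).
by exists n, k; rewrite -muln2 natrM; move: ck => /eqP;
  rewrite mulrBr subr_eq => /eqP->; ring.
Qed.
End LinearTriple.

Section Sl2.
Variables (C : numFieldType) (W : vectType C) (E F H : 'End(W)).
Hypothesis commEF : forall x, E (F x) = F (E x) + H x.
Hypothesis commHE : forall x, H (E x) = E (H x) + 2%:R *: E x.
Hypothesis commHF : forall x, H (F x) = F (H x) - 2%:R *: F x.

Lemma sl2_nilpotentE c u : H u = c *: u -> exists k, iter k E u = 0.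
Proof.
move=> Hu; apply: (@eigen_seq_vanishes _ _ H (fun k => iter k E u) c 2%:R).
- exact: pchar_num.
- by rewrite pnatr_eq0.
- by move=> k; rewrite (iter_raise commHE _ Hu).
Qed.

Lemma sl2_nilpotentF c u : H u = c *: u -> exists k, iter k F u = 0.
Proof.
move=> Hu; apply: (@eigen_seq_vanishes _ _ H (fun k => iter k F u) c (- 2%:R)).
- exact: pchar_num.
- by rewrite oppr_eq0 pnatr_eq0.
- by move=> k; rewrite (iter_lower commHF _ Hu) mulrN.
Qed.

Lemma sl2_integral c u : H u = c *: u -> u != 0 -> exists m : int, c = m%:~R.
Proof.
move=> Hu u0; pose Q x := exists c, H x = c *: x.
have [||||j [k ck]] := @half_integral_eigenvalue C W E F H 2%:R commEF commHE
  commHF Q _ _ _ c u _ Hu u0.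
- by move=> x [b Hx]; exists (b - 2%:R); rewrite commHF Hx linearZ /= scalerBl.
- by move=> x [b /sl2_nilpotentE].
- by move=> x [b /sl2_nilpotentF].
- by exists c.
- exists (j.*2%:Z - k%:Z); rewrite intrB /=.
  apply: (mulfI (x := 2%:R)); first by rewrite pnatr_eq0.
  by rewrite ck mulrC.
Qed.

(** The identity behind [sl2_iterF_inj]: on the eigenspace of [c], [E F] and
    [F^k] commute up to an explicit scalar. *)
Lemma raise_lower_iter k c u : H u = c *: u ->
  E (F (iter k F u)) = iter k F (E (F u) + (k%:R * (c - 1 - k%:R)) *: u).
Proof.
move=> Hu; elim: k => [|k IH]; first by rewrite /= mul0r scale0r addr0.
rewrite iterS commEF IH -iterS (iter_lower commHF k.+1 Hu).
rewrite ![_ + _ *: u]addrC !iter_lfunP addrAC -scalerDl; congr (_ *: _ + _).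
by rewrite -natr1; ring.
Qed.

(** Root strings have no holes and are symmetric because [F^k] is injective on
    the eigenspace of [n >= k]. If [F^(k+1) u = 0] then [F^k] kills
    [E F u + kap u], so [E F u = - kap u] by induction with [kap >= 0], and such a
    vector would start an infinite string [E^m u]. *)
Lemma sl2_iterF_inj n k u : (k <= n)%N -> H u = n%:R *: u -> iter k F u = 0 ->
  u = 0.
Proof.
move=> + Hu; elim: k u Hu => // k IH u Hu kn Fu0.
have := raise_lower_iter k Hu; rewrite -iterS Fu0 linear0.
set kap := _ * _ => /esym /IH u10.
have {}u10 : E (F u) + kap *: u = 0.
  apply: u10; last exact: ltnW.
  rewrite linearD linearZ /= Hu scalerDr commHE commHF Hu linearB !linearZ /=.
  by rewrite scalerN subrK scalerA mulrC -scalerA.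
apply: contrapT => /eqP u0; move/eqP: u10;
  rewrite addr_eq0 -scaleNr => /eqP EFu.
have [m km] := raise_vanishes commEF commHE Hu EFu u0 (sl2_nilpotentE Hu).
have n0 : (0 < n)%N by apply: leq_trans kn.
have : 0 < \sum_(i < m.+1) (n%:R + i%:R * 2%:R : C).
  by rewrite big_ord_recl /= mul0r addr0 ltr_wpDr ?ltr0n // sumr_ge0 // =>
    i _; rewrite addr_ge0 ?mulr_ge0 ?ler0n.
have kap0 : 0 <= kap.
  have -> : kap = k%:R * (n - k.+1)%:R by rewrite natrB // /kap -natr1; ring.
  by rewrite mulr_ge0 ?ler0n.
by rewrite -km oppr_gt0 => /lt_le_trans/(_ kap0); rewrite ltxx.
Qed.

(** This is [raise_vanishes] with [kap = 0]: a sum of positive numbers is not 0. *)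
Lemma sl2_raise_lower_inj c u : H u = c *: u -> 0 < c -> E (F u) = 0 -> u = 0.
Proof.
move=> Hu c0 EFu; apply: contrapT => /eqP u0.
have EFu0 : E (F u) = 0 *: u by rewrite EFu scale0r.
have [m km] := raise_vanishes commEF commHE Hu EFu0 u0 (sl2_nilpotentE Hu).
have : 0 < \sum_(i < m.+1) (c + i%:R * 2%:R : C).
  rewrite big_ord_recl /= mul0r addr0 ltr_wpDr // sumr_ge0 // => i _.
  by rewrite addr_ge0 ?mulr_ge0 ?ler0n // ltW.
by rewrite -km ltxx.
Qed.
End Sl2.

(** The triple [(F, E, - H)] satisfies the same relations. *)
Section Sl2Opposite.
Variables (C : numFieldType) (W : vectType C) (E F H : 'End(W)).
Hypothesis commEF : forall x, E (F x) = F (E x) + H x.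
Hypothesis commHE : forall x, H (E x) = E (H x) + 2%:R *: E x.
Hypothesis commHF : forall x, H (F x) = F (H x) - 2%:R *: F x.

Lemma sl2_iterE_inj n k u : (k <= n)%N -> H u = - n%:R *: u -> iter k E u = 0 ->
  u = 0.
Proof.
move=> kn Hu; apply: (@sl2_iterF_inj C W F E (- H)%VF _ _ _ n) => // [x|x|x|].
- by rewrite opp_lfunE commEF addrK.
- by rewrite !opp_lfunE commHF linearN opprB addrC.
- by rewrite !opp_lfunE commHE linearN opprD.
- by rewrite opp_lfunE Hu scaleNr opprK.
Qed.

Lemma sl2_lower_raise_inj c u : H u = - c *: u -> 0 < c -> F (E u) = 0 -> u = 0.
Proof.
move=> Hu; apply: (@sl2_raise_lower_inj C W F E (- H)%VF) => [x|x|].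
- by rewrite opp_lfunE commEF addrK.
- by rewrite !opp_lfunE commHF linearN opprB addrC.
- by rewrite opp_lfunE Hu scaleNr opprK.
Qed.
End Sl2Opposite.

(** * Representations, weight vectors and the root decomposition *)

Section Lie.
Variables (F : fieldType) (g : lieAlgType F).
Implicit Types x y z : g.

Lemma liebDl x y z : lieb (x + y) z = lieb x z + lieb y z.
Proof. by have := lieb_linearl z 1 x y; rewrite !scale1r. Qed.
Lemma liebDr x y z : lieb x (y + z) = lieb x y + lieb x z.
Proof. by have := lieb_linearr x 1 y z; rewrite !scale1r. Qed.
Lemma lieb0 x : lieb x 0 = 0.
Proof. by have := lieb_linearr x 1 0 0;
  rewrite scale1r !addr0 scale1r => /eqP;
  rewrite eq_sym -subr_eq0 addrK => /eqP. Qed.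
Lemma lieC x y : lieb x y = - lieb y x.
Proof.
have := liebb (x + y); rewrite liebDl !liebDr !liebb addr0 add0r => /eqP.
by rewrite addr_eq0 => /eqP.
Qed.

Lemma lie0b x : lieb 0 x = 0. Proof. by rewrite lieC lieb0 oppr0. Qed.
Lemma liebZr (c : F) x y : lieb x (c *: y) = c *: lieb x y.
Proof. by have := lieb_linearr x c y 0; rewrite !addr0 lieb0 addr0. Qed.
Lemma liebZl (c : F) x y : lieb (c *: x) y = c *: lieb x y.
Proof. by rewrite lieC liebZr [in RHS]lieC scalerN. Qed.
Lemma liebN x y : lieb x (- y) = - lieb x y.
Proof. by rewrite -scaleN1r liebZr scaleN1r. Qed.
Lemma lie_jacobi x y z :
  lieb x (lieb y z) = lieb y (lieb x z) + lieb (lieb x y) z.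
Proof.
have /eqP := lieb_jacobi x y z; rewrite -addrA addr_eq0 => /eqP->.
by rewrite opprD (lieC z x) liebN opprK -lieC.
Qed.

(** The adjoint representation, for which root vectors are weight vectors: every
    statement on weights of a representation then also applies to roots. *)
Definition ad : 'Hom(g, 'End(g)) := linfun (fun x => linfun (lieb x)).

Lemma adE x y : ad x y = lieb x y.
Proof.
have lb z : linfun (lieb z) =1 lieb z by apply/linfunE/lieb_linearr.
rewrite linfunE ?lb // => c u v; apply/lfunP => z.
by rewrite add_lfunE scale_lfunE !lb lieb_linearl.
Qed.

Lemma ad_rep : lie_representation ad.
Proof.
move=> x y; apply/lfunP => z; rewrite add_lfunE opp_lfunE !comp_lfunE !adE.
by rewrite [lieb x (lieb _ _)]lie_jacobi addrC addKr.
Qed.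
End Lie.

Section Rep.
Variables (F : fieldType) (g : lieAlgType F) (a : {vspace g}).
Variables (W : vectType F) (rho : 'Hom(g, 'End(W))).
Hypothesis hrho : lie_representation rho.
Notation ha := (subvs_of a).
Implicit Types (mu nu beta : dual ha) (X Y : g) (v : W).

Lemma rep_comm X Y v : rho X (rho Y v) = rho Y (rho X v) + rho (lieb X Y) v.
Proof. by rewrite hrho add_lfunE opp_lfunE !comp_lfunE addrC subrK. Qed.

Lemma weight_vectorD mu v w : weight_vector rho mu v ->
  weight_vector rho mu w ->
  weight_vector rho mu (v + w).
Proof. by move=> vm wm H; rewrite linearD /= vm wm scalerDr. Qed.

Lemma weight_vectorZ mu (c : F) v : weight_vector rho mu v ->
  weight_vector rho mu (c *: v).
Proof. by move=> vm H; rewrite linearZ /= vm !scalerA mulrC. Qed.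

Lemma weight_vector0 mu : weight_vector rho mu 0.
Proof. by move=> H; rewrite linear0 scaler0. Qed.

Lemma weight_act mu beta X v : root_vector beta X -> weight_vector rho mu v ->
  weight_vector rho (mu + beta) (rho X v).
Proof.
move=> Xb vm H; rewrite rep_comm vm Xb !linearZ /= scale_lfunE -scalerDl.
by rewrite add_lfunE.
Qed.

Lemma weight_iter mu beta X v k : root_vector beta X ->
  weight_vector rho mu v ->
  weight_vector rho (mu + beta *+ k) (iter k (rho X) v).
Proof.
move=> Xb vm; elim: k => [|k IH]; first by rewrite addr0.
by rewrite mulrSr addrA; apply: weight_act.
Qed.

Lemma weight_indep (P : dual ha -> Prop) (s : seq W) nu u :
  (forall y, y \in s -> exists2 mu, P mu & weight_vector rho mu y) ->
  u \in <<s>>%VS -> weight_vector rho nu u -> u != 0 -> P nu.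
Proof.
move=> sP us un u0.
have [|f [mu Pmu <-] /= E] := @joint_eigen_indep F W ha (fun h => rho (vsval h))
  (fun f => exists2 mu : dual ha, P mu & (fun h : ha =>
    mu h : F) = f) nu s u _ us un u0.
  by move=> y /sP[mu Pmu ymu]; exists mu => //; exists mu.
by have <- : mu = nu by apply/lfunP.
Qed.

Lemma rootless_vanish beta X : ~ roots beta -> beta != 0 ->
  root_vector beta X -> X = 0.
Proof.
move=> nr b0 Xb; apply: contrapT => /eqP X0; apply: nr; split=> //.
by exists X.
Qed.

Lemma weightless_vanish mu v : ~ weights rho mu -> weight_vector rho mu v ->
  v = 0.
Proof. by move=> nw vm; apply: contrapT => /eqP v0; apply: nw; exists v. Qed.
End Rep.

Section Root.
Variables (F : fieldType) (g : lieAlgType F) (a : {vspace g}).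
Notation ha := (subvs_of a).
Implicit Types (beta gamma : dual ha) (X Y : g).

Lemma root_vectorE beta X :
  root_vector beta X <-> weight_vector (@ad F g) beta X.
Proof. by split=> Xb H; have := Xb H; rewrite adE. Qed.

Lemma root_vector_lie beta gamma X Y : root_vector beta X ->
  root_vector gamma Y ->
  root_vector (gamma + beta) (lieb X Y).
Proof.
move=> Xb /root_vectorE Yg; apply/root_vectorE; rewrite -adE.
by apply: weight_act => //; apply: ad_rep.
Qed.

Lemma root_vectorD beta X Y : root_vector beta X -> root_vector beta Y ->
  root_vector beta (X + Y).
Proof. by move=> /root_vectorE ? /root_vectorE ?;
  apply/root_vectorE/weight_vectorD. Qed.
Lemma root_vectorZ beta (c : F) X : root_vector beta X ->
  root_vector beta (c *: X).
Proof. by move=> /root_vectorE ?; apply/root_vectorE/weight_vectorZ. Qed.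

Hypothesis car : cartan_subalgebra a.

(** A Cartan subalgebra is its own centralizer, by maximality. *)
Lemma cartan_root0 X : root_vector (0 : dual ha) X <-> X \in a.
Proof.
have [ab mx _] := car; split=> [X0|Xa H]; last first.
  by rewrite zero_lfunE scale0r ab ?subvsP.
apply: mx => y ya; rewrite lieC; have := X0 (vsproj a y).
by rewrite vsprojK // => ->; rewrite zero_lfunE scale0r oppr0.
Qed.

(** The operators [ad h], [h \in a], commute and are diagonalizable, so they can be
    diagonalized one after the other on a basis of [a]. *)
Lemma root_vectors_span X : X \in sspan (fun X =>
  exists beta : dual ha, root_vector beta X).
Proof.
have [ab mx ss] := car.
pose Q (hs : seq ha) X := forall h, h \in hs ->
  exists c : F, lieb (vsval h) X = c *: X.
have step hs : forall X, X \in sspan (Q hs).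
  elim: hs => [|h hs IH] Z; first by apply: mem_sspan.
  apply: (sspan_sub (IH Z)) => y yQ.
  (* vectors with the same eigenvalues as y under hs *)
  pose PU z := forall h', h' \in hs ->
    forall c : F, lieb (vsval h') y = c *: y -> lieb (vsval h') z = c *: z.
  have [|U UP] := @vspace_of_pred F g PU.
    split=> [h' _ c _|z z' Pz Pz' h' hh c cy|k z Pz h' hh c cy].
    - by rewrite lieb0 scaler0.
    - by rewrite liebDr (Pz h' hh c) // (Pz' h' hh c) // scalerDr.
    - by rewrite liebZr (Pz h' hh c) // !scalerA mulrC.
  have [e be ee] := ss _ (subvsP h).
  have sU z : z \in U -> @ad F g (vsval h) z \in U.
    move=> /UP Pz; apply/UP => h' hh c cy.
    by rewrite !adE lie_jacobi (Pz h' hh c) // (ab (vsval h') (vsval h))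
      ?subvsP // lie0b addr0 liebZr.
  have yU : y \in U by apply/UP.
  have ee' z : z \in e -> exists c, @ad F g (vsval h) z = c *: z.
    by move=> /ee[c hz]; exists c; rewrite adE.
  apply: (sspan_sub (diagonalizable_split sU be ee' yU)).
  move=> z [/UP Pz [c cz]]; apply: mem_sspan => h';
    rewrite inE => /predU1P[->|hh].
    by exists c; rewrite -adE.
  by have [c' c'y] := yQ h' hh; exists c'; apply: Pz.
apply: (sspan_sub (step (vbasis {: ha}) X)) => {}X XQ; apply: mem_sspan.
have [->|X0] := eqVneq X 0; first by exists 0;
  apply/root_vectorE/weight_vector0.
have XA (h : ha) : exists c : F, lieb (vsval h) X = c *: X.
  have [|U UP] := @vspace_of_pred F ha (fun h =>
    exists c : F, lieb (vsval h) X = c *: X).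
    split=> [|h1 h2 [c1 E1] [c2 E2]|k h1 [c1 E1]].
    - by exists 0; rewrite linear0 lie0b scale0r.
    - by exists (c1 + c2); rewrite linearD /= liebDl E1 E2 scalerDl.
    - by exists (k * c1); rewrite linearZ /= liebZl E1 scalerA.
  apply/UP; suff /subvP : ({: ha} <= U)%VS by apply; rewrite memvf.
  by rewrite -(span_basis (vbasisP {: ha})); apply/span_subvP => y /XQ /UP.
(* The eigenvalues of a common eigenvector depend linearly on h. *)
pose b (h : ha) : F^o := xget 0 [set c | lieb (vsval h) X = c *: X].
have bP h : lieb (vsval h) X = (b h : F) *: X.
  by have [c cX] := XA h; rewrite /b; case: xgetP => [d -> //|/(_ c)].
exists (linfun b) => h; rewrite linfunE // => c h1 h2.
have := bP (c *: h1 + h2).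
rewrite linearP /= liebDl liebZl !bP scalerA -scalerDl => /eqP.
by rewrite -subr_eq0 -scalerBl scaler_eq0 (negPf X0) orbF subr_eq0 => /eqP.
Qed.

(** The way in which a property is checked on [a] and on root vectors only. *)
Lemma lie_span (U : {vspace g}) : (a <= U)%VS ->
  (forall (beta : dual ha) X, roots beta -> root_vector beta X ->
    X \in U) -> forall X, X \in U.
Proof.
move=> /subvP aU bU X;
  apply: (sspan_sub (root_vectors_span X)) => {}X [beta Xb].
have [b0|b0] := eqVneq beta 0.
  by apply/aU/cartan_root0; rewrite -b0.
have [->|X0] := eqVneq X 0; first exact: mem0v.
by apply: (bU beta) => //; split=> //; exists X.
Qed.
End Root.

(** * Simple systems and the order they define *)

Section SimpleSystem.
Variables (C : numFieldType) (g : lieAlgType C) (a : {vspace g}).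
Notation ha := (subvs_of a).
Variable Psi : {fset dual ha}.
Implicit Types (mu nu beta gamma : dual ha) (X Y : g).
Notation wle := (wle Psi).

Lemma wle_refl mu : wle mu mu.
Proof. by exists (fun=> 0%N); rewrite subrr big1. Qed.

Lemma wle_trans nu mu beta : wle mu nu -> wle nu beta -> wle mu beta.
Proof.
move=> [c cE] [d dE]; exists (fun x => (c x + d x)%N).
rewrite -[beta](subrK nu) -addrA cE dE addrC -big_split /=.
by apply: eq_bigr => x _; rewrite mulrnDr.
Qed.

Lemma wle_translate mu nu beta : wle mu nu -> wle (mu + beta) (nu + beta).
Proof. by move=> [c cE]; exists c; rewrite opprD addrACA subrr addr0. Qed.

Lemma wle_subr0 mu nu : wle 0 (nu - mu) -> wle mu nu.
Proof. by move=> /(wle_translate mu); rewrite add0r subrK. Qed.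

Lemma wle_simple beta : beta \in Psi -> wle 0 beta.
Proof.
move=> bP; exists (fun x => (x == beta) : nat); rewrite subr0.
rewrite (big_fsetD1 beta) //= eqxx big1_fset ?addr0 // => x.
by rewrite !inE => /andP[/negPf->].
Qed.

Hypothesis fPsi : free Psi.

Lemma coweight_exists beta : beta \in Psi ->
  exists h : ha, forall delta, delta \in Psi -> delta h = (delta == beta)%:R.
Proof.
move=> bP; apply: contrapT => /forallNP nh.
have : beta \in <<rem beta Psi>>%VS.
  apply: mem_span_of_kernel => h hX; apply: contrapT => /eqP bh.
  apply: (nh ((beta h : C)^-1 *: h)) => d dP; rewrite linearZ /=.
  have [->|db] := eqVneq d beta; first by rewrite /GRing.scale /= mulVf.
  by rewrite (hX d) ?scaler0 // mem_rem_uniq ?fset_uniq // inE db.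
have := perm_free (perm_to_rem bP); rewrite fPsi free_cons => /esym/andP[/negP].
by [].
Qed.

(** The basis dual to the simple roots, extended by an arbitrary choice; it reads
    off the coefficients of a combination of simple roots. *)
Definition coweight beta : ha :=
  xget 0 [set h : ha | forall delta, delta \in Psi ->
    delta h = (delta == beta)%:R].

Lemma coweightE beta delta : beta \in Psi -> delta \in Psi ->
  delta (coweight beta) = (delta == beta)%:R.
Proof.
move=> /coweight_exists[h hP]; rewrite /coweight;
  case: xgetP => [h' _ /(_ delta)//|].
by move=> /(_ h).
Qed.

Lemma coweight_sum (c : dual ha -> C) beta : beta \in Psi ->
  (\sum_(x <- Psi) c x *: x) (coweight beta) = c beta.
Proof.
move=> bP; rewrite sum_lfunE (big_fsetD1 beta) //= scale_lfunE coweightE //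
  eqxx.
rewrite big1_fset ?addr0 => [|x]; first by rewrite /GRing.scale /= mulr1.
rewrite !inE => /andP[xb xP] _; rewrite scale_lfunE coweightE // (negPf xb).
by rewrite scaler0.
Qed.

(** Evaluation at [depth] is the height function on the root lattice. *)
Definition depth : ha := \sum_(x <- Psi) coweight x.

Lemma wle_coweight mu nu beta : wle mu nu -> beta \in Psi ->
  exists n : nat, (nu - mu) (coweight beta) = n%:R.
Proof.
move=> [c ->] bP; exists (c beta).
under eq_bigr do rewrite -scaler_nat.
by rewrite (coweight_sum (fun x => (c x)%:R)).
Qed.

(** Induction along the order is induction on this integer. *)
Lemma wle_depth mu nu : wle mu nu ->
  exists2 n : nat, (nu - mu) depth = n%:R & n = 0%N -> mu = nu.
Proof.
move=> [c cE]; exists (\sum_(x <- Psi) c x)%N.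
  rewrite /depth linear_sum natr_sum /=; apply: eq_big_seq => x xP.
  rewrite cE; under eq_bigr do rewrite -scaler_nat.
  by rewrite (coweight_sum (fun x => (c x)%:R)).
move/eqP; rewrite sum_nat_seq_eq0 => /allP c0.
apply/eqP; rewrite eq_sym -subr_eq0 cE big_seq big1 // => x /c0.
by rewrite implyTb => /eqP->.
Qed.

Lemma depth_simple beta : beta \in Psi -> beta depth = 1.
Proof.
move=> bP; rewrite /depth linear_sum /= (big_fsetD1 beta) //= coweightE // eqxx.
rewrite big1_fset ?addr0 // => x; rewrite !inE => /andP[xb xP] _.
by rewrite coweightE // eq_sym (negPf xb).
Qed.

Lemma wle_anti mu nu : wle mu nu -> wle nu mu -> mu = nu.
Proof.
move=> /wle_depth[n nE n0] /wle_depth[m mE _]; apply: n0.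
have : (n + m)%:R = 0 :> C.
  by rewrite natrD -nE -mE -[mu - nu]opprB opp_lfunE subrr.
by move/eqP; rewrite pnatr_eq0 addn_eq0 => /andP[/eqP].
Qed.
End SimpleSystem.

(** * The trace form *)

Section Trace.
Variables (F : fieldType) (V : vectType F).
Implicit Types (f h : 'End(V)).
Import passmx.

Lemma lfun_trace_linear : linear (@lfun_trace F V : 'End(V) -> F^o).
Proof. by move=> c f h; rewrite /lfun_trace !linearP. Qed.

Lemma lfun_traceC f h : lfun_trace (f \o h)%VF = lfun_trace (h \o f)%VF.
Proof.
have vb := vbasisP {:V}.
by rewrite /lfun_trace !(mxof_comp _ _ vb) // mxtrace_mulC.
Qed.

Lemma lfun_trace_basis f (b : (\dim {:V}).-tuple V) : basis_of fullv b ->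
  lfun_trace f = \tr (mxof b b f).
Proof.
move=> bb; have vb := vbasisP {:V}; rewrite /lfun_trace.
rewrite -[f in LHS]comp_lfun1r -[f in LHS]comp_lfun1l.
rewrite (mxof_comp _ _ bb) // (mxof_comp _ _ bb) // mxtrace_mulC -mulmxA.
by rewrite -(mxof_comp _ _ vb) // comp_lfun1l mxof1 ?mulmx1 ?(basis_free bb).
Qed.

Lemma lfun_trace_diag f (c : V -> F) (s : seq V) : basis_of fullv s ->
  (forall y, y \in s -> f y = c y *: y) -> lfun_trace f = \sum_(y <- s) c y.
Proof.
move=> bs fs; have sz : size s == \dim {:V}
  by rewrite (size_basis (X := in_tuple s)).
rewrite (lfun_trace_basis f (b := Tuple sz)) // (big_nth 0) big_mkord (eqP sz).
apply: eq_bigr => i _; rewrite !mxE /= vecof_delta fs; last first.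
  by rewrite mem_nth //= (eqP sz).
by rewrite linearZ /= coord_free ?eqxx ?mulr1 // (basis_free bs).
Qed.

(** A basis can be extracted from any spanning sequence, in particular from one
    made of weight vectors. *)
Lemma basis_in_span (s : seq V) : exists b : seq V,
  [/\ free b, <<b>>%VS = <<s>>%VS & {subset b <= s}].
Proof.
elim: s => [|x s [b [fb bs sb]]]; first by exists [::]; rewrite nil_free.
have [xb|xb] := boolP (x \in <<b>>%VS).
  exists b; split=> // [|y /sb ys]; last by rewrite inE ys orbT.
  rewrite span_cons -bs; apply/eqP; rewrite eqEsubv addvSr subv_add -memvE xb.
  by rewrite subvv.
exists (x :: b); split=> [||y]; first by rewrite free_cons xb.
  by rewrite !span_cons bs.
by rewrite !inE => /orP[->//|/sb->]; rewrite orbT.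
Qed.
End Trace.

Section TraceForm.
Variables (F : fieldType) (g : lieAlgType F).
Variables (V : vectType F) (pi : 'Hom(g, 'End(V))).
Hypothesis hpi : lie_representation pi.
Notation tr := (trace_form pi).
Implicit Types X Y Z : g.

Lemma trace_formC X Y : tr X Y = tr Y X.
Proof. exact: lfun_traceC. Qed.

Lemma trace_form_linear X : linear (tr X : g -> F^o).
Proof.
move=> c Y Z; rewrite /trace_form linearP comp_lfunDr -comp_lfunZr.
exact: lfun_trace_linear.
Qed.

Lemma trace_formDr X Y Z : tr X (Y + Z) = tr X Y + tr X Z.
Proof. by have := trace_form_linear X 1 Y Z; rewrite !scale1r. Qed.
Lemma trace_form0r X : tr X 0 = 0.
Proof. by have := trace_formDr X 0 0; rewrite addr0 => /esym/eqP;
  rewrite -subr_eq0 addrK => /eqP. Qed.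
Lemma trace_formZr X c Y : tr X (c *: Y) = c * tr X Y.
Proof. by have := trace_form_linear X c Y 0; rewrite trace_form0r !addr0. Qed.
Lemma trace_formZl X c Y : tr (c *: X) Y = c * tr X Y.
Proof. by rewrite trace_formC trace_formZr trace_formC. Qed.
Lemma trace_formNr X Y : tr X (- Y) = - tr X Y.
Proof. by rewrite -scaleN1r trace_formZr mulN1r. Qed.
Lemma trace_formNl X Y : tr (- X) Y = - tr X Y.
Proof. by rewrite trace_formC trace_formNr trace_formC. Qed.

Lemma trace_form_inv X Y Z : tr (lieb X Y) Z = tr X (lieb Y Z).
Proof.
rewrite /trace_form !hpi comp_lfunDl comp_lfunDr comp_lfunNl comp_lfunNr.
have trB (f h : 'End(V)) : lfun_trace (f - h) = lfun_trace f - lfun_trace h.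
  by rewrite addrC -scaleN1r (lfun_trace_linear (-1) h f) scaleN1r addrC.
rewrite !trB !comp_lfunA; congr (_ - _).
by rewrite [RHS]lfun_traceC comp_lfunA.
Qed.

Variable a : {vspace g}.
(** Invariance under [H \in a] multiplies the left side by [(beta + gamma) H]. *)
Lemma trace_form_orth (beta gamma : dual (subvs_of a)) X Y :
  root_vector beta X -> root_vector gamma Y -> beta + gamma != 0 -> tr X Y = 0.
Proof.
move=> Xb Yg bg; have [H bgH] : exists H, (beta + gamma) H != 0.
  apply: contrapT => /forallNP n0; move/eqP: bg; apply; apply/lfunP => H.
  by rewrite zero_lfunE; apply: contrapT => /eqP /n0.
have := trace_form_inv X (vsval H) Y; rewrite Yg lieC Xb trace_formNl.
rewrite trace_formZl trace_formZr => /esym/eqP; rewrite -addr_eq0 -mulrDl.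
rewrite mulf_eq0 => /orP[|/eqP//]; move: bgH; rewrite add_lfunE addrC.
by move/negPf => ->.
Qed.
End TraceForm.

Lemma weight_nilpotent (C : numFieldType) (g : lieAlgType C) (a : {vspace g})
  (W : vectType C) (rho : 'Hom(g, 'End(W))) (mu beta : dual (subvs_of a)) X v :
  lie_representation rho -> beta != 0 -> root_vector beta X ->
  weight_vector rho mu v -> exists k, iter k (rho X) v = 0.
Proof.
move=> hrho b0 Xb vm; have [H bH] : exists H, beta H != 0.
  apply: contrapT => /forallNP n0; move/eqP: b0; apply; apply/lfunP => H.
  by rewrite zero_lfunE; apply: contrapT => /eqP /n0.
apply: (@eigen_seq_vanishes _ _ (rho (vsval H)) (fun k => iter k (rho X) v)
  (mu H) (beta H)) => //; first exact: pchar_num.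
move=> k; rewrite (weight_iter hrho k Xb vm) add_lfunE -scaler_nat.
by rewrite scale_lfunE.
Qed.

(** * Common non-zeros of affine functions *)

Section Affine.
Variables (F : numFieldType) (W : lmodType F).

Definition nonconstant_affine (f : W -> F) := exists (l : W -> F) c,
  [/\ forall t x y, l (t *: x + y) = t * l x + l y, forall x, f x = l x + c &
      exists x, l x != 0].

Lemma poly_nonroot (p : {poly F}) : p != 0 -> exists t, p.[t] != 0.
Proof.
move=> p0; apply: contrapT => /forallNP all0.
suff : (size [seq k%:R : F | k <- iota 0 (size p)] < size p)%N.
  by rewrite size_map size_iota ltnn.
apply: max_poly_roots => //.
  by apply/allP => t _; rewrite /root; apply: contrapT => /negP /all0.
rewrite map_inj_uniq ?iota_uniq // => j k /eqP.
by rewrite eqr_nat => /eqP.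
Qed.

(** Along a line [z |-> z u + x0] every affine function is a polynomial in [z].
    Starting from a common non-zero [x0] of all but one of them, choose [u] where
    the linear part of the last one does not vanish: then none of these
    polynomials is 0, and neither is their product. *)
Lemma affine_common_nonzero (I : eqType) (f : I -> W -> F) (s : seq I) :
  (forall t, t \in s -> nonconstant_affine (f t)) ->
  exists x, forall t, t \in s -> f t x != 0.
Proof.
elim: s => [|t s IH] sP; first by exists 0.
have [|x0 x0P] := IH; first by move=> u us; apply: sP; rewrite inE us orbT.
have [l [c [lin fE [u lu]]]] := sP t (mem_head _ _).
have line v : v \in t :: s ->
  exists2 q : {poly F}, q != 0 & forall z, q.[z] = f v (z *: u + x0).
  suff gen (l' : W -> F) c' : (forall k x y, l' (k *: x + y) = k * l' x + l' y)
    ->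
      (forall x, f v x = l' x + c') -> l' u != 0 \/ f v x0 != 0 ->
      exists2 q : {poly F}, q != 0 & forall z, q.[z] = f v (z *: u + x0).
    rewrite inE => /predU1P[vt|vs]; first by subst v; apply: (gen l c) => //;
      left.
    have [|l' [c' [lin' fE' _]]] := sP v; first by rewrite inE vs orbT.
    by apply: (gen l' c') => //; right; apply: x0P.
  move=> lin' fE' nz; exists ((l' u)%:P * 'X + (l' x0 + c')%:P).
    rewrite -size_poly_eq0 size_MXaddC polyC_eq0 -fE'.
    by case: nz => /negPf ->; rewrite ?andbF.
  by move=> z; rewrite hornerMXaddC hornerC fE' lin' addrA mulrC.
have [q q0 qE] : exists2 q : {poly F}, q != 0 & forall z, q.[z] != 0 ->
    forall v, v \in t :: s -> f v (z *: u + x0) != 0.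
  elim: (t :: s) line => [|v s' IH'] ln; first by exists 1; rewrite ?oner_eq0.
  have [q q0 qE] := IH' (fun y ys => ln y (@mem_behead _ (v :: s') y ys)).
  have [r r0 rE] := ln v (mem_head _ _).
  exists (r * q); first by rewrite mulf_neq0.
  move=> z; rewrite hornerM mulf_eq0 negb_or => /andP[rz qz] y.
  by rewrite inE => /predU1P[->|/(qE z qz)//]; rewrite -rE.
have [z qz] := poly_nonroot q0.
by exists (z *: u + x0) => v; apply: qE.
Qed.
End Affine.

(** * Lowest weight vectors of an irreducible representation *)

Section Representation.
Variables (C : numClosedFieldType) (g : lieAlgType C) (a : {vspace g}).
Notation ha := (subvs_of a).
Variables (V : vectType C) (pi : 'Hom(g, 'End(V))) (Psi : {fset dual ha}).
Implicit Types (mu nu beta gamma delta : dual ha) (X Y : g).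
Notation wle := (wle Psi).
Notation tr := (trace_form pi).
Notation "''[' x , y ]" := (dform pi x y) (at level 0, format "''[' x ,  y ]").
Hypotheses (hpi : lie_representation pi) (hfaith : faithful pi).
Hypotheses (hirr : irreducible pi setT fullv).
Hypotheses (car : cartan_subalgebra a) (hPsi : simple_system Psi).

(** Weight vectors of distinct weights are independent. *)
Lemma uniq_weights_size (s : seq (dual ha)) : uniq s ->
  (forall mu, mu \in s -> weights pi mu) -> (size s <= \dim {:V})%N.
Proof.
move=> us sw.
have [vs [fvs szs _]] : exists vs : seq V, [/\ free vs, size vs = size s &
    forall y, y \in vs -> exists2 mu, mu \in s & weight_vector pi mu y].
  elim: s us sw => [|x s IH]; first by exists [::]; rewrite nil_free.
  move=> /= /andP[xs us] sw.
  have [mu ms|vs [fvs szs vsP]] := IH us; first by apply: sw;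
    rewrite inE ms orbT.
  have [v v0 vx] := sw x (mem_head _ _).
  exists (v :: vs); split=> /=; last 2 first.
  - by rewrite szs.
  - move=> y; rewrite inE => /predU1P[->|/vsP[mu ms my]].
      by exists x => //; rewrite mem_head.
    by exists mu => //; rewrite inE ms orbT.
  rewrite free_cons fvs andbT; apply/negP => vvs; move/negP: xs; apply.
  exact: (weight_indep (P := fun mu => mu \in s) vsP vvs vx v0).
rewrite -szs; move: fvs; rewrite /free => /eqP <-.
exact/dimvS/subvf.
Qed.

Lemma finite_weights : finite_set (@weights _ _ a _ pi).
Proof.
apply: contrapT => /(infinite_set_fset (\dim {:V}).+1)[B BW].
apply/negP; rewrite -ltnNge ltnS; apply: uniq_weights_size => [|mu /BW //];
  exact: fset_uniq.
Qed.

(** Killed by all negative root spaces. This is stronger than the condition in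
    [lowest_weight] until [- beta] is known to be a root with [beta]
    (see [roots_opp]). *)
Definition killed_below (v : V) := forall beta X, roots beta -> wle beta 0 ->
  root_vector beta X -> pi X v = 0.

(** An invariant property of vectors that holds for a non-zero vector holds for
    all vectors. *)
Lemma irr_full (P : V -> Prop) : subspace_pred P ->
  (forall X v, P v -> P (pi X v)) -> (exists2 v, v != 0 & P v) -> forall v, P v.
Proof.
move=> /vspace_of_pred[U UP] PX [v v0 Pv] w.
have [_ _ /(_ U (subvf _))[]] := hirr.
- by move=> X u _ /UP Pu; apply/UP/PX.
- by move=> U0; move/UP: Pv; rewrite U0 memv0 (negPf v0).
- by move=> Uf; apply/UP; rewrite Uf memvf.
Qed.

(** The classical [V = U(n+) v]. *)
Lemma lowest_span v mu : v != 0 -> weight_vector pi mu v -> killed_below v ->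
  forall u, u \in sspan (fun u =>
    exists2 nu, wle mu nu & weight_vector pi nu u).
Proof.
move=> v0 vm vk.
have [fPsi rPsi sgn] := hPsi.
pose npos X := exists beta, [/\ roots beta, wle 0 beta & root_vector beta X].
(* U is the smallest subspace containing v and stable under n+. *)
pose P x := forall U : {vspace V}, v \in U ->
  (forall X u, npos X -> u \in U -> pi X u \in U) -> x \in U.
have [|U UP] := @vspace_of_pred _ _ P.
  split=> [U *|x y Px Py U vU sU|c x Px U vU sU]; first exact: mem0v.
    by rewrite memvD ?Px ?Py.
  by rewrite memvZ ?Px.
have vU : v \in U by apply/UP.
have pU X u : npos X -> u \in U -> pi X u \in U.
  by move=> pX /UP Pu; apply/UP => U' vU' sU'; apply: (sU' X u pX); apply: Pu.
pose nneg Y := Y \in a \/ exists beta, [/\ roots beta, wle beta 0 &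
  root_vector beta Y].
(* U' is the part of U that a + n- maps into U. It contains v and is
   stable under n+, because [a + n-, n+] is contained in a + n- + n+;
   hence it is all of U. *)
pose P' x := x \in U /\ forall Y, nneg Y -> pi Y x \in U.
have sP' : subspace_pred P'.
  split=> [|x y [xU xY] [yU yY]|c x [xU xY]].
  - by split=> [|Y _]; rewrite ?linear0 mem0v.
  - by split=> [|Y nY]; rewrite ?linearD memvD ?xY ?yY.
  - by split=> [|Y nY]; rewrite ?linearZ /= memvZ ?xY.
have [U' U'P] := vspace_of_pred sP'.
have nU Y u : nneg Y -> u \in U -> pi Y u \in U.
  move=> nY /UP Pu; suff /U'P[_ /(_ Y nY)] : u \in U' by [].
  apply: Pu => [|X w pX /U'P[wU wY]]; apply/U'P.
    split=> // Z [Za|[beta [br bn Zb]]]; last by rewrite (vk beta) ?mem0v.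
    by have := vm (vsproj a Z); rewrite vsprojK // => ->; rewrite memvZ.
  split=> [|Z nZ]; first exact: pU.
  rewrite rep_comm //; apply: memvD; first by apply: pU => //; apply: wY.
  have [b [br bp Xb]] := pX.
  case: nZ => [Za|[d [dr dn Zd]]].
    have := Xb (vsproj a Z); rewrite vsprojK // => ->.
    by rewrite linearZ scale_lfunE memvZ //; apply: pU.
  have brk : root_vector (b + d) (lieb Z X) by apply: root_vector_lie.
  have [bd0|bd0] := eqVneq (b + d) 0.
    by apply: wY; left; apply/cartan_root0 => //; rewrite -bd0.
  have [bdr|nbdr] := pselect (roots (b + d)); last first.
    by rewrite (rootless_vanish nbdr bd0 brk) linear0 zero_lfunE mem0v.
  have [bdp|bdn] := sgn _ bdr.
    by apply: pU => //; exists (b + d).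
  by apply: wY; right; exists (b + d).
have full u : u \in U.
  apply/UP; apply: (@irr_full P) => //; last by exists v => //; apply/UP.
    by split=> [|x y /UP xU /UP yU|c x /UP xU]; apply/UP;
      rewrite ?mem0v ?memvD ?memvZ.
  move=> X w /UP wU; apply/UP.
  have [|S SP] := @vspace_of_pred _ _ (fun X => pi X w \in U).
    split=> [|X1 X2 H1 H2|c X1 H1].
    - by rewrite linear0 zero_lfunE mem0v.
    - by rewrite linearD add_lfunE memvD.
    - by rewrite linearZ scale_lfunE memvZ.
  apply/SP; apply: (lie_span car) => [|b Y br Yb].
    by apply/subvP => Y Ya; apply/SP/nU => //; left.
  apply/SP; have [bp|bn] := sgn _ br; first by apply: pU => //; exists b.
  by apply: nU => //; right; exists b.
move=> u; have /UP := full u; apply=> [|X w [b [br bp Xb]] wS].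
  by apply: mem_sspan; exists mu => //; apply: wle_refl.
have [|S SP] := @vspace_of_pred _ _ (fun w => pi X w \in sspan (fun u =>
  exists2 nu, wle mu nu & weight_vector pi nu u)).
  split=> [|x y Px Py|c x Px]; first by rewrite linear0 mem0v.
    by rewrite linearD memvD.
  by rewrite linearZ memvZ.
apply/SP; apply: (sspan_sub wS) => x [nu mn xn]; apply/SP/mem_sspan.
exists (nu + b); last exact: weight_act.
apply: (wle_trans mn); apply: wle_subr0; rewrite [nu + b]addrC addrK.
exact: bp.
Qed.

(** A weight of [V] is the weight of some member of a spanning family of weight
    vectors. *)
Lemma lowest_min v mu nu : v != 0 -> weight_vector pi mu v -> killed_below v ->
  weights pi nu -> wle mu nu.
Proof.
move=> v0 vm vk [u u0 un].
have /sspanP[s sP us] := lowest_span v0 vm vk u.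
exact: (weight_indep (P := fun nu => wle mu nu) sP us un u0).
Qed.

(** Take a strictly decreasing chain of weights of maximal length: its lowest
    member cannot be lowered any more. *)
Lemma lowest_exists : (exists mu : dual ha, weights pi mu) -> exists mu v,
  [/\ v != 0, weight_vector pi mu v & killed_below v].
Proof.
move=> [mu0 wmu0]; have [fPsi rPsi sgn] := hPsi.
pose D n := `[< exists mu (s : seq (dual ha)), [/\ weights pi mu,
   forall y, y \in s -> [/\ weights pi y, wle mu y & y != mu],
   uniq s & size s = n] >].
have D0 : exists n, D n by exists 0%N; apply/asboolP; exists mu0, [::].
have bD n : D n -> (n <= \dim {:V})%N.
  move=> /asboolP[mu [s [mw sP us <-]]]; apply: uniq_weights_size us _.
  by move=> y /sP[].
case: (ex_maxnP D0 bD) => n /asboolP[mu [s [[v v0 vm] sP us sn]]] maxn.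
exists mu, v; split=> // b X br bn Xb; apply: contrapT => /eqP Xv0.
have [b0 _] := br.
suff /maxn : D n.+1 by rewrite ltnn.
have lt_mu : wle (mu + b) mu by apply: wle_subr0;
  rewrite opprD addrA subrr add0r; have := wle_translate (- b) bn;
  rewrite subrr add0r.
apply/asboolP; exists (mu + b), (mu :: s); split; last 2 first.
- by rewrite /= us andbT; apply/negP => /sP[_ _]; rewrite eqxx.
- by rewrite /= sn.
- by exists (pi X v) => //; apply: weight_act.
- move=> y; rewrite inE => /predU1P[->|/sP[wy my ym]].
    by split=> //; [exists v | rewrite eq_sym -subr_eq0 addrAC subrr add0r].
  split=> //; first exact: wle_trans my.
  apply/eqP => yE; move/eqP: ym; apply; apply: wle_anti my => //.
  by rewrite yE.
Qed.

(** * Non-degeneracy of the trace form *)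

Variable lowpi : dual ha.
Hypothesis hlow : lowest_weight pi (positive_roots Psi) fullv lowpi.

Lemma has_weight : exists mu : dual ha, weights pi mu.
Proof. by have [v [_ v0 vm _]] := hlow; exists lowpi, v. Qed.

(** The trace form on [a] is the sum of the squares of the weights, counted with
    multiplicity; the weights separate points of [a] since [pi] is faithful. *)
Lemma trace_weights : exists ms : seq (dual ha), [/\
  forall mu, mu \in ms -> weights pi mu,
  forall H H' : ha, tr (vsval H) (vsval H') = \sum_(mu <- ms) mu H * mu H' &
  forall H : ha, (forall mu, mu \in ms -> mu H = 0) -> H = 0].
Proof.
have [mu [v [v0 vm vk]]] := lowest_exists has_weight.
have sp := lowest_span v0 vm vk.
have [s sP sf] : exists2 s : seq V, (forall y, y \in s ->
  exists mu : dual ha, weight_vector pi mu y) & (<<s>> = fullv)%VS.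
  have [s sP sE] : exists2 s : seq V, (forall y, y \in s ->
    exists mu : dual ha, weight_vector pi mu y) &
    {subset (vbasis {:V} : seq V) <= <<s>>%VS}.
    elim: (vbasis {:V} : seq V) => [|x e [s sP sE]]; first by exists [::].
    have /sspanP[t tP xt] := sp x; exists (t ++ s) => [y|y].
      by rewrite mem_cat => /orP[/tP[nu _ yn]|/sP//]; exists nu.
    rewrite inE span_cat => /predU1P[->|/sE]; first exact: (subvP (addvSl _ _)).
    exact: (subvP (addvSr _ _)).
  exists s => //; apply/eqP;
    rewrite eqEsubv subvf -{1}(span_basis (vbasisP {:V})).
  exact/span_subvP.
have [b [fb bs sb]] := basis_in_span s.
have bb : basis_of fullv b by rewrite /basis_of bs sf eqxx.
pose wt (y : V) : dual ha := xget 0 [set mu : dual ha | weight_vector pi mu y].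
have wtP y : y \in b -> weight_vector pi (wt y) y.
  by move=> /sb /sP[nu yn]; rewrite /wt; case: xgetP => [d -> //|/(_ nu)].
exists (map wt b); split.
- move=> _ /mapP[y yb ->]; exists y; last exact: wtP.
  by apply: contraTneq fb => y0; apply/negP => /free_not0 /(_ yb);
    rewrite y0 eqxx.
- move=> H H'; rewrite big_map; apply: lfun_trace_diag => // y yb.
  by rewrite comp_lfunE (wtP y yb H') linearZ /= (wtP y yb H) scalerA mulrC.
- move=> H H0; apply/val_inj/hfaith; rewrite linear0; apply/lfunP => u.
  have : u \in <<b>>%VS by rewrite bs sf memvf.
  move/(coord_span (X := in_tuple b)) ->;
    rewrite linear_sum /= zero_lfunE big1 // => i _.
  have ib : (in_tuple b)`_i \in b by apply: mem_nth.
  by rewrite linearZ /= (wtP _ ib) H0 ?map_f // scale0r scaler0.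
Qed.

Lemma lie_opposite_cartan beta X Y : root_vector beta X ->
  root_vector (- beta) Y ->
  exists H : ha, lieb X Y = vsval H.
Proof.
move=> Xb Yb; have := root_vector_lie Xb Yb;
  rewrite addNr => /(cartan_root0 car) Ha.
by exists (vsproj a (lieb X Y)); rewrite vsprojK.
Qed.

(** By the theory of triples every weight takes at [H = [X, Y]] a value
    [r * beta H] with [r] a half integer. If the sum of the squares of these
    values is 0, then [beta H = 0] or all the [r] vanish; in both cases all
    weights vanish at [H]. This is the core of Cartan's criterion. *)
Lemma no_isotropic_coroot beta X Y : beta != 0 ->
  root_vector beta X -> root_vector (- beta) Y ->
  tr (lieb X Y) (lieb X Y) = 0 -> lieb X Y = 0.
Proof.
move=> b0 Xb Yb; have [H HE] := lie_opposite_cartan Xb Yb.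
have [ms [msw trE ms0]] := trace_weights.
rewrite HE trE => tr0.
have rat mu : mu \in ms -> exists2 r : C, r \is Num.real & mu H = r * beta H.
  move=> /msw[v v0 vm].
  have [x|x|x|x|x|x||j [k jk]] := @half_integral_eigenvalue C V (pi X) (pi Y)
    (pi (vsval H)) (beta H)
    _ _ _ (fun x => exists mu, weight_vector pi mu x) _ _ _ (mu H) v _ (vm H)
      v0.
  - by rewrite (rep_comm hpi) HE.
  - by rewrite (rep_comm hpi) Xb linearZ scale_lfunE.
  - by rewrite (rep_comm hpi) Yb opp_lfunE scaleNr linearN linearZ opp_lfunE
      scale_lfunE.
  - by case=> nu xn; exists (nu + - beta); apply: weight_act.
  - by case=> nu xn; apply: (weight_nilpotent hpi b0 Xb xn).
  - by case=> nu xn; apply: (weight_nilpotent hpi _ Yb xn); rewrite oppr_eq0.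
  - by exists mu.
  - exists (2%:R^-1 * (j.*2%:R - k%:R)).
      by rewrite realM ?realV ?realB ?realn.
    by rewrite -mulrA -jk mulKf // pnatr_eq0.
rewrite (_ : H = 0) ?linear0 //; apply: ms0 => mu mums.
have [bH|bH] := eqVneq (beta H : C) 0.
  by have [r _ ->] := rat mu mums; rewrite bH mulr0.
pose r nu : C := nu H / beta H.
have rE nu : nu H = r nu * beta H by rewrite /r divfK.
have rr nu : nu \in ms -> r nu \is Num.real.
  by move=> /rat[x xr xE]; rewrite /r xE mulfK.
have : \sum_(nu <- ms) r nu ^+ 2 = 0.
  apply: (mulIf (x := (beta H : C) ^+ 2)); first by rewrite expf_neq0.
  rewrite mul0r mulr_suml -[RHS]tr0; apply: eq_bigr => nu _.
  by rewrite [in RHS]rE -exprMn expr2.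
rewrite big_seq => /eqP; rewrite psumr_eq0 => [/allP/(_ mu mums)|nu /rr].
  by rewrite mums /= expf_eq0 /= => /eqP r0; rewrite rE r0 mul0r.
by rewrite -realEsqr.
Qed.

(** The radical of the trace form, which will turn out to be 0. *)
Definition in_radical X := forall Y, tr X Y = 0.

Lemma in_radical_lie X Z : in_radical X -> in_radical (lieb Z X).
Proof. by move=> X0 Y;
  rewrite lieC trace_formNl trace_form_inv // X0 oppr0. Qed.

Lemma in_radical_commutes beta X Y : beta != 0 -> in_radical X ->
  root_vector beta X -> root_vector (- beta) Y -> lieb X Y = 0.
Proof.
move=> b0 X0 Xb Yb; apply: (no_isotropic_coroot b0) => //.
by rewrite lieC trace_formNl in_radical_lie ?oppr0.
Qed.

(** Induction on the height of [beta]. The vector [X v] is killed by [n-]: for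
    [Y] of weight [gamma < 0] the bracket [[Y, X]] is again in the radical, and
    it is 0 if [beta + gamma = 0], kills [v] by induction if [beta + gamma > 0]
    and by assumption if [beta + gamma < 0]. Were [X v] non-zero, its weight
    [mu0 + beta] would be the lowest one. *)
Lemma in_radical_kills_lowest v mu0 beta X : v != 0 -> weight_vector pi mu0 v ->
  killed_below v -> roots beta -> in_radical X -> root_vector beta X ->
  pi X v = 0.
Proof.
move=> v0 vm vk br; have [fPsi rPsi sgn] := hPsi.
have [bp|bn] := sgn _ br; last by move=> _ Xb; apply: (vk beta).
have [n bn _] := wle_depth fPsi bp; rewrite subr0 in bn.
elim/ltn_ind: n beta bp bn br X => n IH beta bp bn br X X0 Xb.
have b0 : beta != 0 by case: br.
apply: contrapT => /eqP Xv0.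
have killed : killed_below (pi X v).
  move=> gam Y gr gn Yg; rewrite rep_comm // (vk gam) // linear0 add0r.
  have Zr : root_vector (beta + gam) (lieb Y X) by apply: root_vector_lie.
  have Z0 : in_radical (lieb Y X) by apply: in_radical_lie.
  have [bg0|bg0] := eqVneq (beta + gam) 0.
    have gE : gam = - beta by rewrite -(addKr beta gam) bg0 addr0.
    by rewrite lieC (in_radical_commutes b0) -?gE // oppr0 linear0 zero_lfunE.
  have [bgr|nbgr] := pselect (roots (beta + gam)); last first.
    by rewrite (rootless_vanish nbgr bg0 Zr) linear0 zero_lfunE.
  have [bgp|bgn] := sgn _ bgr; last exact: (vk (beta + gam)).
  have [m mE _] := wle_depth fPsi bgp; rewrite subr0 in mE.
  have [k kE k0] := wle_depth fPsi gn; rewrite sub0r opp_lfunE in kE.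
  apply: (IH m _ (beta + gam)) => //.
  have -> : n = (m + k)%N.
    apply/eqP; rewrite -(eqr_nat C) natrD -mE -kE add_lfunE bn.
    by rewrite addrK.
  rewrite -[X in (X < _)%N]addn0 ltn_add2l lt0n; apply/eqP => /k0 g0.
  by case: gr; rewrite g0 eqxx.
have := lowest_min Xv0 (weight_act hpi Xb vm) killed.
move=> /(_ mu0) [|c cE]; first by exists v.
have : wle beta 0.
  by exists c; rewrite -cE opprD addrA subrr.
by move=> bn'; move/eqP: b0; apply; apply: (wle_anti fPsi bn' bp).
Qed.

(** The vectors killed by all root vectors in the radical form a stable subspace,
    non-zero by [in_radical_kills_lowest], hence everything; [pi] is faithful. *)
Lemma root_in_radical0 beta X : roots beta -> in_radical X ->
  root_vector beta X -> X = 0.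
Proof.
move=> br X0 Xb; have [mu [v [v0 vm vk]]] := lowest_exists has_weight.
pose P (u : V) := forall (gam : dual ha) Y, roots gam -> in_radical Y ->
  root_vector gam Y -> pi Y u = 0.
suff Pall : forall u, P u.
  apply: hfaith; rewrite linear0; apply/lfunP => u; rewrite zero_lfunE.
  exact: (Pall u beta).
have sP : subspace_pred P.
  split=> [gam Y * |x y Px Py gam Y gr Y0 Yg|c x Px gam Y gr Y0 Yg].
  - by rewrite linear0.
  - by rewrite linearD /= (Px gam) ?(Py gam) ?addr0.
  - by rewrite linearZ /= (Px gam) ?scaler0.
apply: (irr_full sP); last first.
  by exists v => // gam Y gr Y0 Yg; apply: in_radical_kills_lowest Yg.
move=> Z u Pu gam Y gr Y0 Yg.
rewrite rep_comm // (Pu gam) // linear0 add0r.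
have [|U UP] := @vspace_of_pred _ _ (fun Z => pi (lieb Y Z) u = 0).
  split=> [|x y Hx Hy|c x Hx].
  - by rewrite lieb0 linear0 zero_lfunE.
  - by rewrite liebDr linearD add_lfunE Hx Hy addr0.
  - by rewrite liebZr linearZ scale_lfunE Hx scaler0.
have g0 : gam != 0 by case: gr.
apply/UP; apply: (lie_span car) => [|del {}Z dr Zd].
  apply/subvP => {}Z Za; apply/UP; rewrite lieC.
  have := Yg (vsproj a Z); rewrite vsprojK // => ->.
  by rewrite linearN linearZ opp_lfunE scale_lfunE (Pu gam) // scaler0 oppr0.
apply/UP; have Wr : root_vector (del + gam) (lieb Y Z)
  by apply: root_vector_lie.
have W0 : in_radical (lieb Y Z).
  by move=> T; rewrite lieC trace_formNl in_radical_lie // oppr0.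
have [dg0|dg0] := eqVneq (del + gam) 0.
  have dE : del = - gam by rewrite -(addrK gam del) dg0 add0r.
  by rewrite (in_radical_commutes g0) -?dE // linear0 zero_lfunE.
have [dgr|ndgr] := pselect (roots (del + gam)); first exact: (Pu (del + gam)).
by rewrite (rootless_vanish ndgr dg0 Wr) linear0 zero_lfunE.
Qed.

(** A root space can only pair with the opposite root space. *)
Lemma root_partner beta X : roots beta -> root_vector beta X -> X != 0 ->
  exists2 Y, root_vector (- beta) Y & tr X Y != 0.
Proof.
move=> br Xb X0; apply: contrapT => /forall2NP nY; move/eqP: X0; apply.
apply: (root_in_radical0 br) => // Y; have b0 : beta != 0 by case: br.
have [|U UP] := @vspace_of_pred _ _ (fun Z => tr X Z = 0).
  split=> [|x y Hx Hy|c x Hx].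
  - by rewrite trace_form0r.
  - by rewrite trace_formDr Hx Hy addr0.
  - by rewrite trace_formZr Hx mulr0.
apply/UP; apply: (lie_span car) => [|del Z dr Zd].
  apply/subvP => Z /(cartan_root0 car) Z0; apply/UP.
  by apply: (trace_form_orth hpi Xb Z0); rewrite addr0.
apply/UP; have [bd0|bd0] := eqVneq (beta + del) 0.
  have dE : del = - beta by rewrite -(addKr beta del) bd0 addr0.
  by have [|/negP] := nY Z; rewrite -?dE // negbK => /eqP.
exact: (trace_form_orth hpi Xb Zd).
Qed.

Lemma roots_opp beta : roots beta -> roots (- beta).
Proof.
move=> br; have [b0 [X X0 Xb]] := br; have [Y Yb XY] := root_partner br Xb X0.
split; first by rewrite oppr_eq0.
by exists Y => //; apply: contraNneq XY => ->; rewrite trace_form0r.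
Qed.

(** An [H] orthogonal to [a] lies in the radical of the form. So does [beta H *: X] for
    a root vector [X], whence [beta H = 0] for all roots: [H] is central, acts by
    a scalar, and the trace of its square vanishes only if this scalar is 0. *)
Lemma cartan_nondegenerate (H : ha) :
  (forall H' : ha, tr (vsval H) (vsval H') = 0) -> H = 0.
Proof.
move=> H0.
have Ha : root_vector (0 : dual ha) (vsval H) by apply/cartan_root0 => //;
  apply: subvsP.
have iso : in_radical (vsval H).
  move=> Y; have [|U UP] := @vspace_of_pred _ _ (fun Z => tr (vsval H) Z = 0).
    split=> [|x y Hx Hy|c x Hx].
    - by rewrite trace_form0r.
    - by rewrite trace_formDr Hx Hy addr0.
    - by rewrite trace_formZr Hx mulr0.
  apply/UP; apply: (lie_span car) => [|del Z [d0 _] Zd].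
    by apply/subvP => Z Za; apply/UP; rewrite -(vsprojK Za).
  by apply/UP; apply: (trace_form_orth hpi Ha Zd); rewrite add0r.
have rootH beta : roots beta -> beta H = 0.
  move=> br; have [b0 [X X0 Xb]] := br; apply: contrapT => /eqP bH.
  move/eqP: X0; apply; apply: (root_in_radical0 br) => // Y.
  have : tr (lieb (vsval H) X) Y = 0 by rewrite trace_form_inv.
  by rewrite Xb trace_formZl => /eqP; rewrite mulf_eq0 (negPf bH) => /eqP.
have [mu [v [v0 vm vk]]] := lowest_exists has_weight.
(* H acts on V by the scalar mu H. *)
have scal u : pi (vsval H) u = (mu H : C) *: u.
  apply: (irr_full (P := fun u => pi (vsval H) u = (mu H : C) *: u)).
  - split=> [|x y Hx Hy|c x Hx].
    + by rewrite linear0 scaler0.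
    + by rewrite linearD /= Hx Hy scalerDr.
    + by rewrite linearZ /= Hx !scalerA mulrC.
  - move=> X w wH; rewrite rep_comm // wH linearZ /=.
    suff -> : lieb (vsval H) X = 0 by rewrite linear0 zero_lfunE addr0.
    have [|U UP] := @vspace_of_pred _ _ (fun Z => lieb (vsval H) Z = 0).
      split=> [|x y Hx Hy|c x Hx].
      - by rewrite lieb0.
      - by rewrite liebDr Hx Hy addr0.
      - by rewrite liebZr Hx scaler0.
    apply/UP; apply: (lie_span car) => [|del Z dr Zd]; last first.
      by apply/UP; rewrite Zd rootH // scale0r.
    apply/subvP => Z Za; apply/UP; have [ab _ _] := car.
    by rewrite ab ?subvsP.
  - by exists v => //; apply: vm.
have [ms [msw trE ms0]] := trace_weights.
have msc nu : nu \in ms -> nu H = mu H.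
  move=> /msw[w w0 /(_ H)]; rewrite scal => /eqP.
  by rewrite -subr_eq0 -scalerBl scaler_eq0 (negPf w0) orbF subr_eq0 => /eqP.
apply: ms0 => nu nums; have := H0 H; rewrite trE.
rewrite (eq_big_seq (fun=> mu H * mu H)); last by move=> x /msc ->.
rewrite big_const_seq count_predT iter_addr_0 => /eqP.
rewrite mulrn_eq0 mulf_eq0 orbb => /orP[/eqP/size0nil ms_nil|/eqP mu0].
  by rewrite ms_nil in nums.
by rewrite msc.
Qed.

Lemma flatE (H H' : ha) : flat pi H H' = tr (vsval H) (vsval H').
Proof.
rewrite /flat linfunE // => c x y; rewrite linearP /=.
exact: trace_form_linear.
Qed.

Lemma flat_linear : linear (@flat _ _ a _ pi).
Proof.
move=> c x y; apply/lfunP => z; rewrite add_lfunE scale_lfunE !flatE linearP /=.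
by rewrite trace_formC trace_form_linear trace_formC [tr _ (vsval
  y)]trace_formC.
Qed.

Lemma flat_sharp mu : flat pi (sharp pi mu) = mu.
Proof.
rewrite /sharp -(linfunE flat_linear).
apply: limg_lfunVK; suff ->
  : limg (linfun (@flat _ _ a _ pi)) = fullv by apply: memvf.
apply/eqP; rewrite eqEdim subvf limg_dim_eq.
  by rewrite !dimvf /= /dim /= muln1.
rewrite capfv; apply/eqP; rewrite -subv0; apply/subvP => H.
rewrite memv_ker linfunE; last exact: flat_linear.
move=> /eqP fH; rewrite memv0; apply/eqP/cartan_nondegenerate => H'.
by rewrite -flatE fH zero_lfunE.
Qed.

Lemma sharp_flat (H : ha) : sharp pi (flat pi H) = H.
Proof.
apply/eqP; rewrite -subr_eq0; apply/eqP/cartan_nondegenerate => H'.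
have := flatE (sharp pi (flat pi H)) H'; rewrite flat_sharp flatE => E.
by rewrite linearB /= trace_formC trace_formDr trace_formNr ![tr (vsval H')
  _]trace_formC E subrr.
Qed.

Lemma dformE mu nu : dform pi mu nu = mu (sharp pi nu).
Proof. by rewrite -[in RHS](flat_sharp mu) flatE. Qed.

Lemma dformC mu nu : dform pi mu nu = dform pi nu mu.
Proof. exact: trace_formC. Qed.

(** * Coroots, root strings and positivity *)

Let dE := dformE.

Lemma dformDl mu nu beta : '[mu + nu, beta] = '[mu, beta] + '[nu, beta].
Proof. by rewrite !dE add_lfunE. Qed.
Lemma dformZl (c : C) mu beta : '[c *: mu, beta] = c * '[mu, beta].
Proof. by rewrite !dE scale_lfunE. Qed.
Lemma dformNl mu beta : '[- mu, beta] = - '[mu, beta].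
Proof. by rewrite -scaleN1r dformZl mulN1r. Qed.
Lemma dformBl mu nu beta : '[mu - nu, beta] = '[mu, beta] - '[nu, beta].
Proof. by rewrite dformDl dformNl. Qed.
Lemma dformMnl mu n beta : '[mu *+ n, beta] = n%:R * '[mu, beta].
Proof. by rewrite -scaler_nat dformZl. Qed.
Lemma dformDr mu nu beta : '[beta, mu + nu] = '[beta, mu] + '[beta, nu].
Proof. by rewrite !(dformC beta) dformDl. Qed.
Lemma dformNr mu beta : '[beta, - mu] = - '[beta, mu].
Proof. by rewrite !(dformC beta) dformNl. Qed.
Lemma dform_suml (I : Type) (s : seq I) (P : pred I) (f : I -> dual ha) beta :
  '[\sum_(i <- s | P i) f i, beta] = \sum_(i <- s | P i) '[f i, beta].
Proof. by rewrite !dE sum_lfunE; apply: eq_bigr => i _; rewrite dE. Qed.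

(** Both sides have the same product with every [H'] in [a], by invariance. *)
Lemma lie_root_coroot beta X Y : root_vector beta X -> root_vector (- beta) Y ->
  lieb X Y = tr X Y *: vsval (sharp pi beta).
Proof.
move=> Xb Yb; have [H HE] := lie_opposite_cartan Xb Yb.
suff : H - tr X Y *: sharp pi beta = 0.
  by move=> /eqP; rewrite subr_eq0 HE => /eqP->; rewrite linearZ.
apply: cartan_nondegenerate => H'.
rewrite trace_formC linearB /= trace_formDr trace_formNr.
rewrite trace_formZr.
rewrite ![tr (vsval H') _]trace_formC -HE trace_form_inv // lieC Yb.
rewrite opp_lfunE scaleNr opprK trace_formZr.
rewrite -flatE flat_sharp.
by rewrite mulrC subrr.
Qed.

Lemma dform_root_neq0 beta : roots beta -> '[beta, beta] != 0.
Proof.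
move=> br; have [b0 [X X0 Xb]] := br.
have [Y Yb XY] := root_partner br Xb X0.
apply/eqP => bb0.
have := no_isotropic_coroot b0 Xb Yb.
rewrite (lie_root_coroot Xb Yb) trace_formZr trace_formZl -/(dform pi beta
  beta).
rewrite bb0 !mulr0 => /(_ erefl)/eqP; rewrite scaler_eq0 (negPf XY) /=.
move=> /eqP sb0; have /eqP : beta = 0; last by rewrite (negPf b0).
rewrite -(flat_sharp beta).
by apply/lfunP => H; rewrite flatE sb0 trace_formC trace_form0r zero_lfunE.
Qed.

(** The value of [mu] at the coroot of [beta]. *)
Definition cint mu beta := 2%:R * '[mu, beta] / '[beta, beta].

Lemma cintD mu nu beta : cint (mu + nu) beta = cint mu beta + cint nu beta.
Proof. by rewrite /cint dformDl mulrDr mulrDl. Qed.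
Lemma cintN mu beta : cint (- mu) beta = - cint mu beta.
Proof. by rewrite /cint dformNl mulrN mulNr. Qed.
Lemma cintMn mu beta n : cint (mu *+ n) beta = n%:R * cint mu beta.
Proof. by rewrite /cint dformMnl mulrCA -!mulrA. Qed.
Lemma cint_root beta : roots beta -> cint beta beta = 2%:R.
Proof. by move=> /dform_root_neq0 bb; rewrite /cint mulfK. Qed.
Lemma cint_eq0 mu beta : roots beta -> (cint mu beta == 0) = ('[mu, beta] == 0).
Proof.
move=> /dform_root_neq0 /negPf bb.
by rewrite /cint !mulf_eq0 invr_eq0 pnatr_eq0 bb orbF.
Qed.

Lemma sl2_triple beta X : roots beta -> root_vector beta X -> X != 0 ->
  exists Y (H : ha), [/\ root_vector (- beta) Y, lieb X Y = vsval H &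
    forall mu, mu H = cint mu beta].
Proof.
move=> br Xb X0.
have [Y Yb XY] := root_partner br Xb X0.
pose k := 2%:R / ('[beta, beta]).
exists ((k / tr X Y) *: Y), (k *: sharp pi beta); split.
- exact: root_vectorZ.
- by rewrite liebZr (lie_root_coroot Xb Yb) scalerA divfK // linearZ.
- by move=> mu; rewrite linearZ /= -dE /GRing.scale /= /cint /k mulrAC.
Qed.

Lemma root_vector_nontrivial beta : roots beta ->
  exists2 X, root_vector beta X & X != 0.
Proof. by move=> [b0 [X X0 Xb]]; exists X. Qed.

Section Rep.
Variables (W : vectType C) (rho : 'Hom(g, 'End(W))).
Hypothesis hrho : lie_representation rho.

Section Triple.
Variables (beta : dual ha) (X Y : g) (H : ha).
Hypotheses (br : roots beta).
Hypotheses (Xb : root_vector beta X) (Yb : root_vector (- beta) Y).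
Hypotheses (XY : lieb X Y = vsval H) (HE : forall mu, mu H = cint mu beta).

Lemma triple_commEF x : rho X (rho Y x) = rho Y (rho X x) + rho (vsval H) x.
Proof. by rewrite (rep_comm hrho) XY. Qed.
Lemma triple_commHE x : rho (vsval H) (rho X x) = rho X (rho (vsval H) x) +
  2%:R *: rho X x.
Proof. by rewrite (rep_comm hrho) Xb linearZ scale_lfunE HE cint_root. Qed.
Lemma triple_commHF x : rho (vsval H) (rho Y x) = rho Y (rho (vsval H) x) -
  2%:R *: rho Y x.
Proof.
by rewrite (rep_comm hrho) Yb linearZ scale_lfunE HE cintN cint_root // scaleNr.
Qed.

Lemma triple_weight mu v : weight_vector rho mu v ->
  rho (vsval H) v = cint mu beta *: v.
Proof. by move=> vm; rewrite vm HE. Qed.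
End Triple.

(** Used both for weights of [pi] and, through [ad], for roots. *)
Lemma cint_int mu beta : weights rho mu -> roots beta ->
  exists m : int, cint mu beta = m%:~R.
Proof.
move=> [v v0 vm] br; have [X Xb X0] := root_vector_nontrivial br.
have [Y [H [Yb XY HE]]] := sl2_triple br Xb X0.
exact: (sl2_integral (triple_commEF XY) (triple_commHE br Xb HE) (triple_commHF
  br Yb HE) (triple_weight HE vm) v0).
Qed.

(** The vector [Y^k v] is non-zero, by [sl2_iterF_inj]. *)
Lemma string_down mu beta n k : weights rho mu -> roots beta ->
  cint mu beta = n%:R -> (k <= n)%N -> weights rho (mu - beta *+ k).
Proof.
move=> [v v0 vm] br mn kn; have [X Xb X0] := root_vector_nontrivial br.
have [Y [H [Yb XY HE]]] := sl2_triple br Xb X0.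
exists (iter k (rho Y) v); last by rewrite -mulNrn; apply: weight_iter.
apply: contra_neq v0; have := triple_weight HE vm; rewrite mn.
exact: (sl2_iterF_inj (triple_commEF XY) (triple_commHE br Xb HE)
  (triple_commHF br Yb HE) kn).
Qed.

Lemma string_up mu beta n k : weights rho mu -> roots beta ->
  cint mu beta = - n%:R -> (k <= n)%N -> weights rho (mu + beta *+ k).
Proof.
move=> [v v0 vm] br mn kn; have [X Xb X0] := root_vector_nontrivial br.
have [Y [H [Yb XY HE]]] := sl2_triple br Xb X0.
exists (iter k (rho X) v); last exact: weight_iter.
apply: contra_neq v0; have := triple_weight HE vm; rewrite mn.
exact: (sl2_iterE_inj (triple_commEF XY) (triple_commHE br Xb HE)
  (triple_commHF br Yb HE) kn).
Qed.
End Rep.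

Lemma roots_ad beta : roots beta -> weights (@ad C g) beta.
Proof. by move=> [_ [X X0 Xb]]; exists X => //; apply/root_vectorE. Qed.

Lemma ad_roots beta : weights (@ad C g) beta -> beta != 0 -> roots beta.
Proof. by move=> [X X0 /root_vectorE Xb] b0; split=> //; exists X. Qed.

(** Subtract from [Y] the multiple of [X] that makes it orthogonal to [Z]: the
    difference commutes with [Z] and has eigenvalue 2 under [H], so it is 0. *)
Lemma root_space_dim1 beta X Y : roots beta -> root_vector beta X -> X != 0 ->
  root_vector beta Y -> exists c : C, Y = c *: X.
Proof.
move=> br Xb X0 Yb; have [Z [H [Zb XZ HE]]] := sl2_triple br Xb X0.
have XZ0 : tr X Z != 0.
  apply/eqP => XZ0; have := lie_root_coroot Xb Zb; rewrite XZ0 scale0r XZ => H0.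
  have := cint_root br; rewrite -HE.
  have -> : H = 0 by apply/val_inj; apply: etrans H0 (esym (linear0 _)).
  by rewrite linear0 => /esym/eqP; rewrite pnatr_eq0.
pose c := tr Y Z / tr X Z; exists c; apply/eqP; rewrite -subr_eq0; apply/eqP.
have Db : root_vector beta (Y - c *: X).
  by apply: root_vectorD => //; rewrite -scaleNr; apply: root_vectorZ.
have DZ : lieb (Y - c *: X) Z = 0.
  rewrite (lie_root_coroot Db Zb) trace_formC trace_formDr trace_formNr
    trace_formZr.
  by rewrite ![tr Z _]trace_formC /c divfK // subrr scale0r.
have adr := @ad_rep C g; have /root_vectorE Dw := Db.
apply: (sl2_raise_lower_inj (triple_commEF adr XZ) (triple_commHE adr br Xb HE)
  (triple_weight HE Dw)).
  by rewrite cint_root // ltr0n.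
by rewrite !adE [lieb Z _]lieC DZ oppr0 lieb0.
Qed.

(** The norm of [beta] is the sum over the weights [mu] of
    [(mu, beta)^2 = (cint mu beta / 2)^2 * (beta, beta)^2]. *)
Lemma dform_weights_root beta : roots beta -> exists ms : seq (dual ha),
  [/\ forall mu, mu \in ms -> weights pi mu,
     forall H H' : ha, tr (vsval H) (vsval H') = \sum_(mu <- ms) mu H * mu H' &
     1 = '[beta, beta] * \sum_(mu <- ms) (cint mu beta / 2%:R) ^+ 2].
Proof.
move=> br; have [ms [msw trE ms0]] := trace_weights.
exists ms; split=> //; have bb := dform_root_neq0 br.
apply: (mulfI bb); rewrite mulr1 {1}/dform trE mulrA mulr_sumr.
apply: eq_bigr => mu _; rewrite -!dE /cint.
have two : (2%:R : C) != 0 by rewrite pnatr_eq0.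
by field; rewrite bb.
Qed.

Lemma cint_real mu beta : weights pi mu -> roots beta ->
  cint mu beta \is Num.real.
Proof. by move=> wm br; have [m ->] := cint_int hpi wm br; rewrite realz. Qed.

Lemma dform_root_gt0 beta : roots beta -> 0 < '[beta, beta].
Proof.
move=> br; have [ms [msw _ bS]] := dform_weights_root br.
set S := \sum_(_ <- _) _ in bS; have bb := dform_root_neq0 br.
have S0 : 0 <= S.
  rewrite /S big_seq sumr_ge0 // => mu /msw wm.
  by rewrite -realEsqr realM ?realV ?realn ?cint_real.
have Sn0 : S != 0 by apply: contra_eq_neq bS => ->; rewrite mulr0 oner_eq0.
have -> : '[beta, beta] = S^-1 by apply: (mulIf Sn0); rewrite -bS mulVf.
by rewrite invr_gt0 lt0r Sn0.
Qed.

Lemma dformE_cint mu beta : roots beta ->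
  '[mu, beta] = cint mu beta * '[beta, beta] / 2%:R.
Proof.
move=> br; have bb := dform_root_neq0 br.
by rewrite /cint divfK // mulrC mulKf ?pnatr_eq0.
Qed.

Lemma dform_real mu beta : weights pi mu -> roots beta ->
  '[mu, beta] \is Num.real.
Proof.
move=> wm br; rewrite dformE_cint // realM ?realV ?realn // realM ?cint_real //.
exact/gtr0_real/dform_root_gt0.
Qed.

Lemma dform_real_root gamma beta : roots gamma -> roots beta ->
  '[gamma, beta] \is Num.real.
Proof.
move=> gr br; rewrite dformE_cint // realM ?realV ?realn // realM //.
  by have [m ->] := cint_int (@ad_rep C g) (roots_ad gr) br; rewrite realz.
exact/gtr0_real/dform_root_gt0.
Qed.

(** * Simple roots and the coefficients of weights *)

(** Negatives of roots are roots, so the two notions of lowest weight vector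
    agree. *)
Lemma lowpi_killed v : weight_vector pi lowpi v ->
  (forall beta X, positive_roots Psi beta -> root_vector (- beta) X ->
    pi X v = 0) ->
  killed_below v.
Proof.
move=> vm vk gam X gr gn Xg; apply: (vk (- gam)); last by rewrite opprK.
split; first exact: roots_opp.
by have := wle_translate (- gam) gn; rewrite subrr add0r.
Qed.

Lemma simple_root beta : beta \in Psi -> roots beta.
Proof. by have [_ + _] := hPsi; apply. Qed.

Lemma free_simple : free Psi.
Proof. by have [] := hPsi. Qed.

Lemma lowpi_min mu : weights pi mu -> wle lowpi mu.
Proof.
by have [v [_ v0 vm vk]] := hlow;
  apply: (lowest_min v0 vm (lowpi_killed vm vk)).
Qed.

(** The coefficient of [beta] in [mu - lowpi], for a simple root [beta]: a natural
    number when [mu] is a weight. *)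
Definition coef mu beta : C := (mu - lowpi) (coweight Psi beta).

Lemma coef_nat mu beta : weights pi mu -> beta \in Psi ->
  exists n : nat, coef mu beta = n%:R.
Proof. by move=> /lowpi_min lm bP; apply: (wle_coweight free_simple lm bP). Qed.

Lemma coefD mu nu beta :
  coef (mu + nu) beta = coef mu beta + nu (coweight Psi beta).
Proof. by rewrite /coef addrAC [LHS]add_lfunE. Qed.

Lemma coefB mu nu beta :
  coef (mu - nu) beta = coef mu beta - nu (coweight Psi beta).
Proof. by rewrite coefD opp_lfunE. Qed.

Lemma coef_subn mu beta delta n : beta \in Psi -> delta \in Psi ->
  coef (mu - delta *+ n) beta =
    coef mu beta - (if delta == beta then n%:R else 0).
Proof.
move=> bP dP; rewrite coefB -scaler_nat scale_lfunE coweightE ?free_simple //.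
by rewrite /GRing.scale /=; case: eqP; rewrite ?mulr1 ?mulr0.
Qed.

Lemma coef_sub mu beta delta : beta \in Psi -> delta \in Psi ->
  coef (mu - delta) beta = coef mu beta - (delta == beta)%:R.
Proof. by move=> bP dP; rewrite coefB coweightE ?free_simple. Qed.

Lemma coef_pos mu beta n : beta \in Psi -> weights pi (mu - beta *+ n) ->
  exists m : nat, coef mu beta = (n + m)%:R.
Proof.
move=> bP /coef_nat/(_ bP)[m]; rewrite coef_subn // eqxx => mE.
by exists m; rewrite addnC natrD -mE subrK.
Qed.

Lemma coef_expand mu : weights pi mu ->
  mu - lowpi = \sum_(x <- Psi) coef mu x *: x.
Proof.
move=> /lowpi_min[c cE]; rewrite cE; apply: eq_big_seq => x xP.
rewrite /coef cE; under [in RHS]eq_bigr do rewrite -scaler_nat.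
by rewrite (coweight_sum free_simple (fun x => (c x)%:R)) // scaler_nat.
Qed.

Lemma simple_sub_nonroot beta delta : beta \in Psi -> delta \in Psi ->
  ~ roots (beta - delta).
Proof.
move=> bP dP r; have [r0 _] := r; have bd : beta != delta by rewrite -subr_eq0.
have [_ _ /(_ _ r)[p|p]] := hPsi.
  have [n] := wle_coweight free_simple p dP.
  rewrite subr0 add_lfunE opp_lfunE !coweightE ?free_simple // (negPf bd) eqxx
    sub0r.
  by move=> /eqP; rewrite eq_sym -subr_eq0 opprK -natrD pnatr_eq0 addn1.
have [n] := wle_coweight free_simple p bP.
rewrite sub0r opprB add_lfunE opp_lfunE !coweightE ?free_simple // eqxx.
rewrite [delta == _]eq_sym (negPf bd) sub0r.
by move=> /eqP; rewrite eq_sym -subr_eq0 opprK -natrD pnatr_eq0 addn1.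
Qed.

(** Otherwise the [delta]-string through [beta + delta] would contain
    [beta - delta]. *)
Lemma simple_orth_nonroot beta delta : beta \in Psi -> delta \in Psi ->
  '[beta, delta] = 0 -> ~ roots (beta + delta).
Proof.
move=> bP dP bd r; have dr := simple_root dP.
have b_d : beta != delta.
  by apply: contraTneq (dform_root_gt0 dr) => bdE; rewrite -{1}bdE bd ltxx.
have c2 : cint (beta + delta) delta = 2%:R.
  by rewrite cintD cint_root // /cint bd mulr0 mul0r add0r.
have := string_down (@ad_rep C g) (roots_ad r) dr c2 (leqnn 2).
rewrite mulr2n opprD addrA addrK => /ad_roots; rewrite subr_eq0 => /(_ b_d).
exact: simple_sub_nonroot.
Qed.

(** Otherwise the [delta]-string through [beta + 2 delta] would contain
    [beta - delta]. *)
Lemma serre_nonroot beta delta : beta \in Psi -> delta \in Psi ->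
  beta != delta ->
  cint beta delta = -1 -> ~ roots (beta + delta *+ 2).
Proof.
move=> bP dP b_d bd r; have dr := simple_root dP.
have c3 : cint (beta + delta *+ 2) delta = 3%:R.
  by rewrite cintD cintMn cint_root // bd -natrM -[3%N]/(4 - 1)%N natrB //
    addrC.
have := string_down (@ad_rep C g) (roots_ad r) dr c3 (leqnn 3).
rewrite [delta *+ 3]mulrSr opprD addrA addrK => /ad_roots;
  rewrite subr_eq0 => /(_ b_d).
exact: simple_sub_nonroot.
Qed.

(** The bracket lies in a root space that is 0. *)
Lemma orth_commute beta delta X Y u : beta \in Psi -> delta \in Psi ->
  '[beta, delta] = 0 -> root_vector (- beta) X -> root_vector (- delta) Y ->
  pi X (pi Y u) = pi Y (pi X u).
Proof.
move=> bP dP bd Xb Yd; rewrite rep_comm //.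
have Zr : root_vector (- (delta + beta)) (lieb X Y).
  by rewrite opprD; apply: root_vector_lie.
have nr := simple_orth_nonroot bP dP bd.
have nr' : ~ roots (- (delta + beta)).
  by move=> /roots_opp; rewrite opprK addrC.
have s0 : - (delta + beta) != 0.
  rewrite oppr_eq0 addr_eq0; apply/eqP => E.
  by have := dform_root_gt0 (simple_root dP);
    rewrite {1}E dformNl bd oppr0 ltxx.
by rewrite (rootless_vanish nr' s0 Zr) linear0 zero_lfunE addr0.
Qed.

(** The Serre relation between adjacent simple roots of equal length. *)
Lemma serre_vanish beta delta X Y Z u : beta \in Psi -> delta \in Psi ->
  cint beta delta = -1 -> root_vector (- delta) X -> root_vector (- delta) Y ->
  root_vector (- beta) Z -> pi (lieb X (lieb Y Z)) u = 0.
Proof.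
move=> bP dP bd Xd Yd Zb.
have b_d : beta != delta.
  apply: contra_eq_neq bd => ->; rewrite (cint_root (simple_root dP)).
  by rewrite -subr_eq0 opprK natr1 pnatr_eq0.
have nr := serre_nonroot bP dP b_d bd.
have Wr : root_vector (- (beta + delta *+ 2)) (lieb X (lieb Y Z)).
  rewrite mulr2n addrA !opprD.
  by apply: root_vector_lie => //; apply: root_vector_lie.
have nr' : ~ roots (- (beta + delta *+ 2)) by move=> /roots_opp; rewrite opprK.
have s0 : - (beta + delta *+ 2) != 0.
  rewrite oppr_eq0; apply/eqP => E.
  have : cint (beta + delta *+ 2) delta = 3%:R.
    by rewrite cintD cintMn (cint_root (simple_root dP)) bd -natrM -[3%N]/(4 -
      1)%N natrB // addrC.
  rewrite E -[X in cint X _](subrr beta) cintD cintN subrr => /esym/eqP.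
  by rewrite pnatr_eq0.
by rewrite (rootless_vanish nr' s0 Wr) linear0 zero_lfunE.
Qed.

Definition killed_by beta v := forall X, root_vector (- beta) X -> pi X v = 0.

(** Since [(beta, beta) > 0], some simple [delta] has [(beta, delta) > 0]. *)
Lemma positive_root_descent beta : roots beta -> wle 0 beta ->
  beta \notin Psi ->
  exists delta (m : nat), [/\ delta \in Psi, cint beta delta = m.+1%:R,
    roots (beta - delta) & wle 0 (beta - delta)].
Proof.
move=> br bp bP; have [c cE] := bp; rewrite subr0 in cE.
have [delta dP cd] : exists2 delta, delta \in Psi & 0 < '[beta, delta].
  apply: contrapT => /forall2NP nd; have := dform_root_gt0 br.
  rewrite {2}cE dformC dform_suml big_seq; apply/negP;
    rewrite -real_leNgt ?real0 //; last first.
    rewrite sum_real // => x xP; rewrite dformMnl realM ?realn //.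
    exact: dform_real_root (simple_root xP) br.
  rewrite sumr_le0 // => x xP; rewrite dformMnl mulr_ge0_le0 ?ler0n // dformC.
  have xr := simple_root xP; rewrite real_leNgt ?real0 ?dform_real_root //.
  by apply/negP => H; case: (nd x).
have dr := simple_root dP;
  have [m mE] := cint_int (@ad_rep C g) (roots_ad br) dr.
have m0 : 0 < m.
  by rewrite -(ltr0z C) -mE /cint divr_gt0 ?dform_root_gt0 // mulr_gt0 // ltr0n.
case: m mE m0 => // -[//|m] mE _; exists delta, m.
have b_d : beta != delta by apply: contraNneq bP => ->.
have bdr : roots (beta - delta).
  apply: ad_roots; last by rewrite subr_eq0.
  by have := string_down (@ad_rep C g) (roots_ad br) dr (n := m.+1) mE (k := 1)
    isT.
split=> //; have [_ _ /(_ _ bdr)[//|bdn]] := hPsi.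
have [n nE n0] := wle_depth free_simple bdn.
have [k kE k0] := wle_depth free_simple bp.
move: nE; rewrite sub0r opprD opprK add_lfunE opp_lfunE (depth_simple
  free_simple) //.
rewrite subr0 in kE; rewrite kE => /eqP;
  rewrite addrC subr_eq -natrD -[1]/(1%:R) eqr_nat => /eqP nk.
have k1 : (0 < k)%N by rewrite lt0n; apply/eqP => /k0 b0; case: br;
  rewrite -b0 eqxx.
case: n nk n0 => [|n] nk n0; last by case: k nk k1 {kE k0} => // k;
  rewrite addSn addnS.
by have := n0 erefl => /eqP; rewrite subr_eq0 (negPf b_d).
Qed.

(** The negative root spaces are generated by those of the negatives of simple
    roots: with [delta] as in [positive_root_descent], [X] is a multiple of
    [[F, [E, X]]], because the root space of [- beta] is a line and [F E] is
    injective on it. *)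
Lemma simple_generate v : (forall beta, beta \in Psi -> killed_by beta v) ->
  killed_below v.
Proof.
move=> vk gam X gr gn Xg.
have := roots_opp gr;
  have : wle 0 (- gam) by have := wle_translate (- gam) gn; rewrite subrr add0r.
have {}Xg : root_vector (- (- gam)) X by rewrite opprK.
move: (- gam) Xg => {gr gn}beta Xb bp br.
have [n bn _] := wle_depth free_simple bp; rewrite subr0 in bn.
elim/ltn_ind: n beta bn br bp X Xb => n IH beta bn br bp X Xb.
have [bP|bP] := boolP (beta \in Psi); first exact: vk Xb.
have [X0|X0] := eqVneq X 0; first by rewrite X0 linear0 zero_lfunE.
have [delta [m [dP bdm bdr bdp]]] := positive_root_descent br bp bP.
have dr := simple_root dP.
have [E Ed E0] := root_vector_nontrivial dr.
have [F [H [Fd EF HE]]] := sl2_triple dr Ed E0.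
have EX : root_vector (- (beta - delta)) (lieb E X).
  by have := root_vector_lie Ed Xb; rewrite opprB addrC.
have FEX : root_vector (- beta) (lieb F (lieb E X)).
  by have := root_vector_lie Fd EX; rewrite opprB addrAC subrr add0r.
have [k kE] := root_space_dim1 (roots_opp br) Xb X0 FEX.
have k0 : k != 0.
  apply: contraNneq X0 => k0; rewrite k0 scale0r in kE.
  have /root_vectorE Xw := Xb; have adr := @ad_rep C g.
  have c_X := triple_weight HE Xw; rewrite cintN bdm in c_X.
  apply/eqP; apply: (sl2_lower_raise_inj (triple_commEF adr EF) (triple_commHF
    adr dr Fd HE) c_X).
    by rewrite ltr0n.
  by rewrite !adE.
have EXv : pi (lieb E X) v = 0.
  case: n IH bn => [|n] IH bn.
    have [q] := wle_depth free_simple bp; rewrite subr0 bn => /esym/eqP.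
    by rewrite pnatr_eq0 => /eqP-> /(_ erefl) b0; case: br; rewrite -b0 eqxx.
  apply: (IH n _ (beta - delta)) => //.
  by rewrite add_lfunE opp_lfunE bn (depth_simple free_simple) // -natr1 addrK.
have -> : X = k^-1 *: lieb F (lieb E X) by rewrite kE scalerA mulVf ?scale1r.
rewrite linearZ scale_lfunE; apply/eqP; rewrite scaler_eq0; apply/orP; right;
  apply/eqP.
have := rep_comm hpi F (lieb E X) v; rewrite EXv (vk delta) // !linear0 add0r.
by move<-.
Qed.

Lemma killed_by_simple_lowpi v mu : v != 0 -> weight_vector pi mu v ->
  (forall beta, beta \in Psi -> killed_by beta v) -> mu = lowpi.
Proof.
move=> v0 vm /simple_generate vk; apply: (wle_anti free_simple).
  by apply: (lowest_min v0 vm vk); have [u [_ u0 um _]] := hlow; exists u.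
by apply: lowpi_min; exists v.
Qed.

(** By irreducibility only [lowpi] is the weight of a vector killed by all
    negative simple root vectors. *)
Lemma descent v mu : v != 0 -> weight_vector pi mu v -> mu != lowpi ->
  exists beta X, [/\ beta \in Psi, root_vector (- beta) X & pi X v != 0].
Proof.
move=> v0 vm ml; apply: contrapT => nb; move/eqP: ml; apply.
apply: (killed_by_simple_lowpi v0 vm) => beta bP X Xb.
by apply: contrapT => /eqP Xv; apply: nb; exists beta, X.
Qed.

Lemma weights_descent mu : weights pi mu -> mu != lowpi ->
  exists2 beta, beta \in Psi & weights pi (mu - beta).
Proof.
move=> [v v0 vm] /(descent v0 vm)[beta [X [bP Xb Xv]]]; exists beta => //.
by exists (pi X v) => //; apply: weight_act.
Qed.

Lemma killed_by_nonweight v mu beta : weight_vector pi mu v ->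
  ~ weights pi (mu - beta) -> killed_by beta v.
Proof.
move=> vm nw X Xb; apply: (weightless_vanish nw); exact: weight_act.
Qed.

(** Lowering by [beta] would make the coefficient negative. *)
Lemma coef0_killed v mu beta : weight_vector pi mu v -> beta \in Psi ->
  coef mu beta = 0 -> killed_by beta v.
Proof.
move=> vm bP c0; apply: (killed_by_nonweight vm) => w.
have [m] := coef_pos (n := 1) bP w.
by rewrite c0 => /esym/eqP; rewrite pnatr_eq0.
Qed.

(** Every connected part of the support of [mu - lowpi] meets a simple root that
    is not orthogonal to [lowpi]. Going down from [mu], consider the step that
    removes the last simple root [beta] of [A]: there [(mu, beta) = (beta, beta)],
    so the string through [mu] contains [mu - 2 beta], whose coefficient at
    [beta] is negative. *)
Lemma support_connected (A : pred (dual ha)) mu : weights pi mu ->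
  (forall beta, beta \in Psi -> A beta -> '[lowpi, beta] = 0) ->
  (forall beta delta, beta \in Psi -> delta \in Psi -> A beta -> ~~ A delta ->
     coef mu delta != 0 -> '[delta, beta] = 0) ->
  forall beta, beta \in Psi -> A beta -> coef mu beta = 0.
Proof.
move=> wm lA; have [n nE _] := wle_depth free_simple (lowpi_min wm).
elim: n mu wm nE => [|n IH] mu wm nE sA beta bP Ab.
  have [q qE q0] := wle_depth free_simple (lowpi_min wm).
  move: qE; rewrite nE => /eqP; rewrite eqr_nat => /eqP q00.
  by rewrite /coef -(q0 (esym q00)) subrr zero_lfunE.
have ml : mu != lowpi.
  by apply: contra_eq_neq nE => ->; rewrite subrr zero_lfunE eq_sym pnatr_eq0.
have [delta dP wd] := weights_descent wm ml.
have supp x : x \in Psi -> coef (mu - delta) x != 0 -> coef mu x != 0.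
  move=> xP; rewrite coef_sub //; have [<-|_] := eqVneq delta x;
    last by rewrite subr0.
  have [m ->] := coef_pos (n := 1) dP wd.
  by rewrite pnatr_eq0.
have {}IH : forall beta, beta \in Psi -> A beta -> coef (mu - delta) beta = 0.
  apply: IH => // [|b d bP' dP' Ab' Ad cd]; last exact: sA (supp _ dP' cd).
  rewrite addrAC add_lfunE nE opp_lfunE (depth_simple free_simple) //.
  by rewrite -natr1 addrK.
have [db|db] := eqVneq delta beta; last first.
  by have := IH beta bP Ab; rewrite coef_sub // (negPf db) subr0.
rewrite db in dP wd IH supp *.
have c1 : coef mu beta = 1.
  by have := IH beta bP Ab; rewrite coef_sub // eqxx => /eqP;
    rewrite subr_eq0 => /eqP.
have br := simple_root bP.
(* All other simple roots in the support are orthogonal to beta. *)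
have mb : '[mu, beta] = '[beta, beta].
  rewrite -[mu](subrK lowpi) dformDl lA // addr0 coef_expand // dform_suml.
  rewrite (big_fsetD1 beta) //= c1 scale1r big1_fset ?addr0 // => x.
  rewrite !inE => /andP[xb xP] _; rewrite dformZl.
  have [Ax|Ax] := boolP (A x).
    have := IH x xP Ax; rewrite coef_sub // eq_sym (negPf xb) subr0 => ->.
    by rewrite mul0r.
  have [->|cx] := eqVneq (coef mu x) 0; first by rewrite mul0r.
  by rewrite (sA _ _ bP xP Ab Ax cx) mulr0.
have c2 : cint mu beta = 2%:R by rewrite -(cint_root br) /cint mb.
have w2 := string_down hpi wm br c2 (leqnn 2).
have [m] := coef_pos bP w2; rewrite c1 -[1]/(1%:R) => /eqP; rewrite eqr_nat.
by [].
Qed.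

(** * The form on a_Theta *)

Variable Theta : {fset dual ha}.
Hypothesis sub_Theta : forall beta, beta \in Theta -> beta \in Psi.

Lemma mem_a_Theta (H : ha) :
  H \in a_Theta Theta <-> forall beta, beta \in Theta -> beta H = 0.
Proof.
split=> [/(@mem_bigcap_lker _ _ _ _ id) h beta bT|h].
  by rewrite -(nth_index 0 bT); apply: h; rewrite index_mem.
by apply/(@mem_bigcap_lker _ _ _ _ id) => i ilt t0; apply/h/mem_nth.
Qed.

Lemma lowest_Theta_vector mu : lowest_weights_Theta pi Psi Theta mu ->
  exists v, [/\ v != 0, weight_vector pi mu v &
    forall beta, beta \in Theta -> killed_by beta v].
Proof.
move=> [U _ [v [_ v0 vm vk]]]; exists v; split=> // beta bT X Xb.
apply: (vk beta) => //; split; last by move=> H /mem_a_Theta; apply.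
by split; [apply/simple_root/sub_Theta|apply/wle_simple/sub_Theta].
Qed.

Lemma mem_orthoa (U : {vspace ha}) (H : ha) :
  H \in orthoa pi U <-> forall H', H' \in U -> flat pi H' H = 0.
Proof.
split=> [/mem_bigcap_lker h H' H'U|h]; last first.
  apply/mem_bigcap_lker => j jlt t0; apply: h; apply: vbasis_mem.
  exact: mem_nth.
have [|S SP] := @vspace_of_pred _ _ (fun H' => flat pi H' H = 0).
  split=> [|y z Hy Hz|c y Hy].
  - by rewrite flatE linear0 trace_formC trace_form0r.
  - by rewrite -[y]scale1r flat_linear scale1r add_lfunE Hy Hz addr0.
  - by rewrite flatE linearZ /= trace_formZl -flatE Hy mulr0.
apply/SP; suff /subvP : (U <= S)%VS by apply.
rewrite -(span_basis (vbasisP U)); apply/span_subvP => y yU; apply/SP.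
by rewrite -(nth_index 0 yU); apply: h; rewrite index_mem.
Qed.

(** If [H] is orthogonal to [a_Theta], then [flat H] is a combination of [Theta].
    Its complex conjugate [H'] is killed by [Theta] too, because the products of
    roots are real, so [(H, H') = 0]; but this is the sum of the [|mu H|^2] over
    the weights [mu]. *)
Lemma a_Theta_nondegenerate (H : ha) :
  H \in a_Theta Theta -> H \in orthoa pi (a_Theta Theta) -> H = 0.
Proof.
move=> HT HO.
have : flat pi H \in <<Theta>>%VS.
  apply: mem_span_of_kernel => h hT; rewrite flatE trace_formC -flatE.
  by move/mem_orthoa: HO; apply; apply/mem_a_Theta.
move/(coord_span (X := in_tuple (enum_fset Theta))).
set c := (fun j => coord (in_tuple (enum_fset Theta)) j (flat pi H)).
rewrite -/c => fH.
have HE : H = \sum_j c j *: sharp pi (in_tuple (enum_fset Theta))`_j.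
  rewrite -[LHS]sharp_flat fH /sharp linear_sum; apply: eq_bigr => j _.
  by rewrite linearZ.
(* complex conjugate with respect to the real span of the coroots *)
pose H' : ha := \sum_j (c j)^* *: sharp pi (in_tuple (enum_fset Theta))`_j.
have inT (j : 'I_(size (enum_fset Theta))) : (in_tuple (enum_fset Theta))`_j
  \in Theta.
  exact: (@mem_nth _ 0 (enum_fset Theta) j (ltn_ord j)).
have rT (j : 'I_(size (enum_fset Theta))) : roots (in_tuple (enum_fset
  Theta))`_j by apply/simple_root/sub_Theta/inT.
have conjE mu : (forall beta, beta \in Theta -> '[mu, beta] \is Num.real) ->
  mu H' = (mu H)^*.
  move=> mr; rewrite HE /H' !linear_sum rmorph_sum; apply: eq_bigr => j _.
  by rewrite !linearZ /= -!dE rmorphM /= (CrealP (mr _ (inT j))).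
have flat0 : flat pi H H' = 0.
  rewrite fH sum_lfunE big1 // => j _; rewrite scale_lfunE conjE.
    by move/mem_a_Theta: HT => ->; rewrite ?conjC0 ?scaler0 ?inT.
  by move=> b bT; apply: dform_real_root (rT j) (simple_root (sub_Theta bT)).
have [ms [msw trE ms0]] := trace_weights.
apply: ms0 => mu mums; move/eqP: flat0; rewrite flatE trE big_seq.
rewrite psumr_eq0 => [/allP/(_ mu mums)|nu nums]; last first.
  rewrite conjE ?mul_conjC_ge0 // => b bT.
  by apply: dform_real (msw _ nums) (simple_root (sub_Theta bT)).
rewrite mums conjE /= => [|b bT]; first by rewrite mul_conjC_eq0 => /eqP.
by apply: dform_real (msw _ mums) (simple_root (sub_Theta bT)).
Qed.

Lemma a_Theta_directsum :
  (a_Theta Theta :&: orthoa pi (a_Theta Theta) = 0)%VS /\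
  (a_Theta Theta + orthoa pi (a_Theta Theta) = fullv)%VS.
Proof.
have cap0 : (a_Theta Theta :&: orthoa pi (a_Theta Theta) = 0)%VS.
  apply/eqP; rewrite -subv0; apply/subvP => H; rewrite memv_cap memv0.
  by move=> /andP[HT HO]; apply/eqP/a_Theta_nondegenerate.
split=> //; apply/eqP; rewrite eqEdim subvf dimv_disjoint_sum // addnC.
by have := dim_bigcap_lker (vbasis (a_Theta Theta)) (flat pi);
  rewrite size_tuple.
Qed.

(** The functional is [flat H] on [a_Theta]: its extension by 0 on the orthogonal
    complement is [flat H] itself. *)
Lemma ext_Theta_eval (H : ha) : H \in a_Theta Theta ->
  exists lambda : dual_Theta Theta,
    forall mu, '[ext_Theta pi lambda, mu] = mu H.
Proof.
move=> HT; have [cap0 full] := a_Theta_directsum.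
exists (flat pi H \o linfun (vsval : subvs_of (a_Theta Theta) -> ha))%VF => mu.
suff -> : ext_Theta pi (flat pi H \o linfun (vsval : subvs_of (a_Theta Theta)
  -> ha))%VF = flat pi H.
  by rewrite dformC dE sharp_flat.
apply/lfunP => H'; rewrite /ext_Theta !comp_lfunE !lfunE /= vsprojK ?memv_pi //.
have := daddv_pi_add cap0 (w := H'); rewrite full memvf => /(_ isT) E.
rewrite -[in RHS]E linearD /= [X in _ + X](_ : _ = 0) ?addr0 //.
by move/mem_orthoa: (memv_pi (orthoa pi (a_Theta Theta)) (a_Theta Theta) H');
  apply.
Qed.

Lemma ext_Theta_linear : linear (@ext_Theta _ _ _ _ pi Theta).
Proof.
by move=> c y z; rewrite /ext_Theta !comp_lfunDl !comp_lfunZl.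
Qed.

Lemma res_ThetaE mu (lambda : dual_Theta Theta) :
  res_Theta pi Theta mu lambda = '[ext_Theta pi lambda, mu].
Proof.
rewrite /res_Theta linfunE // => c y z.
by rewrite ext_Theta_linear dformDl dformZl.
Qed.

Lemma coweight_a_Theta beta : beta \in Psi -> beta \notin Theta ->
  coweight Psi beta \in a_Theta Theta.
Proof.
move=> bP bT; apply/mem_a_Theta => d d_T.
rewrite (coweightE free_simple bP (sub_Theta d_T)).
by case: eqP => // E; rewrite -E d_T in bT.
Qed.

(** The coweight of a simple root outside [Theta] lies in [a_Theta], where the two
    weights agree. *)
Lemma res_Theta_coef mu nu : (forall lambda : dual_Theta Theta,
    '[ext_Theta pi lambda, mu - nu] = 0) ->
  forall beta, beta \in Psi -> beta \notin Theta -> coef mu beta = coef nu beta.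
Proof.
move=> h beta bP bT; have [lam lamE] := ext_Theta_eval (coweight_a_Theta bP bT).
have := h lam; rewrite lamE add_lfunE opp_lfunE => /eqP;
  rewrite subr_eq0 => /eqP E.
by rewrite /coef !add_lfunE E.
Qed.

Lemma ext_form_affine nu :
  (exists lambda : dual_Theta Theta, '[ext_Theta pi lambda, nu] != 0) ->
  forall (f : dual_Theta Theta -> C) c,
    (forall lam, f lam = '[ext_Theta pi lam, nu] + c) -> nonconstant_affine f.
Proof.
move=> nz f c fE; exists (fun lam => '[ext_Theta pi lam, nu]), c; split=> //.
by move=> t y z; rewrite ext_Theta_linear dformDl dformZl.
Qed.

(** * The weights below an extremal low weight *)

Section Chain.
Variables (alpha walpha : dual ha) (w : seq (dual ha)).
Hypothesis aP : alpha \in Psi.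
Hypothesis hwalpha : extremal_low_weight pi Psi alpha walpha.
Hypothesis hw : weight_chain pi Psi walpha w.
Notation K := (size w).
Notation x := (nth 0 w).

Lemma mem_chain mu : mu \in w <-> weights pi mu /\ wle mu walpha.
Proof.
have [_ /seteqP[s1 s2]] := hw; split=> [mw|mm]; first exact: (s1 mu mw).
exact: (s2 mu mm).
Qed.

Lemma chain_lt i j : (i < j < K)%N -> wle (x i) (x j) /\ x i != x j.
Proof. by move=> /andP[ij jK]; have [/(_ i.+1 j.+1) h _] := hw; apply: h. Qed.

Lemma chain_le i j : (i <= j)%N -> (j < K)%N -> wle (x i) (x j).
Proof.
rewrite leq_eqVlt => /predU1P[->|ij] jK; first exact: wle_refl.
by have [] := @chain_lt i j; rewrite ?ij.
Qed.

Lemma chain_weight i : (i < K)%N -> weights pi (x i) /\ wle (x i) walpha.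
Proof. by move=> iK; apply/mem_chain/mem_nth. Qed.

Lemma chain_uniq i j : (i < K)%N -> (j < K)%N -> x i = x j -> i = j.
Proof.
move=> iK jK xij; case: (ltngtP i j) => // ij.
  by have [|_] := @chain_lt i j; rewrite ?ij // xij eqxx.
by have [|_] := @chain_lt j i; rewrite ?ij // xij eqxx.
Qed.

(** The chain lists all weights below [walpha], so it is an initial segment. *)
Lemma below_chain mu j : weights pi mu -> (j < K)%N -> wle mu (x j) ->
  exists2 i, (i <= j)%N & mu = x i.
Proof.
move=> wm jK mj; have [_ jw] := chain_weight jK.
have /mem_chain/(nthP 0)[i iK iE] : weights pi mu /\ wle mu walpha.
  by split=> //; apply: wle_trans jw.
have [ij|ji] := leqP i j; first by exists i.
exists j => //; apply: (wle_anti free_simple) => //; rewrite -iE.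
by apply: chain_le => //; apply: ltnW.
Qed.

Lemma size_chain_gt0 : (0 < K)%N.
Proof.
have [[wa _] _] := hwalpha; have : walpha \in w by apply/mem_chain;
  split=> //; apply: wle_refl.
by case: (w).
Qed.

Lemma chain_last : x K.-1 = walpha.
Proof.
have K0 := size_chain_gt0; have lK : (K.-1 < K)%N by rewrite prednK.
have [_ lw] := chain_weight lK; apply: (wle_anti free_simple) => //.
have [[wa _] _] := hwalpha.
have /mem_chain/(nthP 0)[i iK <-] : weights pi walpha /\ wle walpha walpha.
  by split=> //; apply: wle_refl.
by apply: chain_le => //; rewrite -ltnS prednK.
Qed.

Lemma chain_head : x 0 = lowpi.
Proof.
have K0 := size_chain_gt0; have [w0 _] := chain_weight K0.
have low_w : weights pi lowpi by have [v [_ v0 vm _]] := hlow; exists v.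
by have [k] := below_chain low_w K0 (lowpi_min w0); rewrite leqn0 => /eqP->.
Qed.

(** There is no room for a third weight between [mu] and [mu + beta]. *)
Lemma below_chain_simple mu j beta : weights pi mu -> beta \in Psi ->
  (j < K)%N ->
  mu + beta = x j -> (0 < j)%N /\ mu = x j.-1.
Proof.
move=> wm bP jK mb.
have mj : wle mu (x j) by apply: wle_subr0; rewrite -mb addrAC subrr add0r;
  apply: wle_simple.
have [i ij mE] := below_chain wm jK mj.
have b0 : beta != 0 by have [] := simple_root bP.
have {}ij : (i < j)%N.
  rewrite ltn_neqAle ij andbT; apply: contraNneq b0 => ijE.
  by rewrite -(addKr mu beta) mb mE ijE addNr.
have j0 : (0 < j)%N by apply: leq_ltn_trans ij.
split=> //; rewrite mE; have : (i <= j.-1)%N by rewrite -ltnS prednK.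
rewrite leq_eqVlt => /predU1P[-> //|ij1].
have [h1 n1] := @chain_lt i j.-1 ltac:(by rewrite ij1 prednK // ltnW).
have [h2 n2] := @chain_lt j.-1 j ltac:(by rewrite prednK // leqnn).
have [p pE p0] := wle_depth free_simple h1.
have [q qE q0] := wle_depth free_simple h2.
have : (q + p)%:R = 1%:R :> C.
  rewrite natrD -pE -qE -[1%:R](depth_simple free_simple bP).
  have -> : beta = x j - x j.-1 + (x j.-1 - x i)
    by rewrite subrKA -mb -mE addrAC subrr add0r.
  by rewrite [RHS]add_lfunE.
move/eqP; rewrite eqr_nat => /eqP.
case: p p0 {pE} => [/(_ erefl)/eqP|p _]; first by rewrite (negPf n1).
case: q q0 {qE} => [/(_ erefl)/eqP|q _]; first by rewrite (negPf n2).
by rewrite addnS.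
Qed.

(** The sequence of simple roots of the chain, numbered from 0, with [alpha] at
    the end. *)
Definition gam i := if i == K.-1 then alpha else x i.+1 - x i.

Lemma gam_last : gam K.-1 = alpha. Proof. by rewrite /gam eqxx. Qed.

Lemma gam_step i : (i.+1 < K)%N -> x i + gam i = x i.+1.
Proof.
move=> iK; rewrite /gam ifN; first by rewrite addrC subrK.
by apply: contraTneq iK => ->; rewrite prednK ?ltnn // size_chain_gt0.
Qed.

Lemma gam_simple i : (i < K)%N -> gam i \in Psi.
Proof.
move=> iK; have K0 := size_chain_gt0.
have : (i <= K.-1)%N by rewrite -ltnS prednK.
rewrite leq_eqVlt => /predU1P[->|]; first by rewrite gam_last.
rewrite -ltnS prednK // => iK1; have [w1 _] := chain_weight iK1.
have n1 : x i.+1 != lowpi.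
  by rewrite -chain_head eq_sym; have [] := @chain_lt 0 i.+1 iK1.
have [beta bP wb] := weights_descent w1 n1.
have [_ E] := below_chain_simple wb bP iK1 (subrK _ _).
suff -> : gam i = beta by [].
by rewrite -(addKr (x i) (gam i)) gam_step // -E opprB subrK.
Qed.

(** [x i] is an extremal low weight for [gam i], by descending induction on [i].
    Write [ga] and [dl] for [gam i] and [gam i.+1]; then [(ga, dl) != 0]. Let [j]
    be minimal with [(x j, ga) != 0]. If the product is positive, the string
    through [x j] contains its reflection, an earlier [x j'] with
    [(x j', ga) != 0]. If it is negative, [x j + ga] is a weight, some [x j'] with
    [j' <= i], and [(x j', dl) = (ga, dl) != 0] contradicts the induction
    hypothesis. If finally [(x i, ga) = 0], the string through [x i + ga] contains
    [x i - ga], for which the product is not 0. *)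
Lemma gam_extremal i : (i < K)%N ->
  (forall j, (j < i)%N -> '[x j, gam i] = 0) /\ '[x i, gam i] != 0.
Proof.
have K0 := size_chain_gt0.
move: {2}(K.-1 - i)%N (erefl (K.-1 - i)%N) => d; elim: d i => [|d IH] i id iK.
  have iE : i = K.-1 by apply/eqP;
    rewrite eqn_leq -ltnS prednK // iK /= -subn_eq0 id.
  have [[wa na] mina] := hwalpha; rewrite iE gam_last chain_last;
    split=> // j ji.
  apply: contrapT => /eqP nj.
  have jK : (j < K)%N by apply: ltn_trans ji _; rewrite prednK.
  have [wj jw] := chain_weight jK.
  have E : j = K.-1.
    apply: chain_uniq => //; first by rewrite prednK.
    by rewrite chain_last; apply: mina.
  by rewrite E ltnn in ji.
have iK1 : (i.+1 < K)%N by rewrite -ltn_predRL -subn_gt0 id.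
have [orth1 nz1] : (forall j, (j < i.+1)%N ->
  '[x j, gam i.+1] = 0) /\ '[x i.+1, gam i.+1] != 0.
  by apply: IH; rewrite // subnS id.
set dl := gam i.+1 in orth1 nz1; set ga := gam i.
have step : x i + ga = x i.+1 by apply: gam_step.
have gP : ga \in Psi by apply: gam_simple.
have gr := simple_root gP.
have gd : '[ga, dl] != 0.
  by move: nz1; rewrite -step dformDl orth1 // add0r.
have ga0 : ga != 0 by case: gr.
have orth0 j : (j < i)%N -> '[x j, ga] = 0.
  elim/ltn_ind: j => j IHj ji; apply/eqP; rewrite -cint_eq0 //.
  have jK : (j < K)%N by apply: ltn_trans ji iK.
  have [wj jw] := chain_weight jK.
  have [m mE] := cint_int hpi wj gr; rewrite mE.
  case: m mE => [[|m]|m] mE; first by rewrite eqxx.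
    have wm := string_down hpi wj gr mE (leqnn _).
    have [j' j'j jE] : exists2 j', (j' <= j)%N & x j - ga *+ m.+1 = x j'.
      apply: below_chain => //; apply: wle_subr0;
        rewrite opprB addrCA subrr addr0.
      have [c cE] := wle_simple gP; exists (fun b => (c b * m.+1)%N).
      by rewrite subr0 -[ga]subr0 cE -sumrMnl;
        under [RHS]eq_bigr do rewrite mulrnA.
    have {}j'j : (j' < j)%N.
      rewrite ltn_neqAle j'j andbT; apply/eqP => E;
        have := congr1 (cint^~ ga) jE.
      rewrite E cintD cintN cintMn cint_root // => /eqP.
      rewrite -subr_eq0 addrAC subrr sub0r oppr_eq0 -natrM pnatr_eq0 muln2.
      by rewrite double_eq0.
    have := IHj j' j'j (ltn_trans j'j ji); rewrite -jE => /eqP.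
    rewrite -cint_eq0 // cintD cintN cintMn mE cint_root // => /eqP.
    rewrite -[_%:~R]/(m.+1%:R) mulr_natr mulr2n opprD addrA subrr sub0r => /eqP.
    by rewrite oppr_eq0.
  have wm : weights pi (x j + ga *+ 1).
    by apply: (string_up hpi wj gr (n := m.+1)); rewrite // mE NegzE mulrNz.
  rewrite mulr1n in wm.
  have jE1 : wle (x j + ga) (x i.+1).
    by rewrite -step; apply: wle_translate; apply: chain_le => //; apply: ltnW.
  have [j' j'i jE] := below_chain wm iK1 jE1.
  have {}j'i : (j' < i.+1)%N.
    rewrite ltn_neqAle j'i andbT; apply: contraTneq ji => E.
    suff -> : j = i by rewrite ltnn.
    by apply: chain_uniq => //; apply: (addIr ga); rewrite step jE E.
  by move: gd; have := orth1 _ j'i;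
    rewrite -jE dformDl orth1 ?add0r ?(ltn_trans ji) // => ->; rewrite eqxx.
split=> //; apply/negP; rewrite -cint_eq0 // => /eqP ci.
have [w1 _] := chain_weight iK1; have [wi _] := chain_weight iK.
have c2 : cint (x i.+1) ga = 2%:R by rewrite -step cintD ci add0r cint_root.
have := string_down hpi w1 gr c2 (leqnn 2);
  rewrite -step mulr2n opprD addrA addrK => wm.
have [i0 E] := @below_chain_simple (x i - ga) i ga wm gP iK (subrK _ _).
have : '[x i.-1, ga] = 0 by apply: orth0; rewrite prednK.
rewrite -E => /eqP; rewrite -cint_eq0 // cintD cintN ci cint_root // sub0r
  oppr_eq0.
by rewrite pnatr_eq0.
Qed.

Lemma gam_orth i j : (i.+1 < j)%N -> (j < K)%N -> '[gam i, gam j] = 0.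
Proof.
move=> ij jK; have [o _] := gam_extremal jK.
rewrite -(addKr (x i) (gam i)) gam_step ?(ltn_trans ij) // addrC dformBl !o
  ?subrr //.
exact: ltnW.
Qed.

Lemma gam_adj i : (i.+1 < K)%N -> '[gam i, gam i.+1] != 0.
Proof.
move=> iK; have [o nz] := gam_extremal iK.
by move: nz; rewrite -gam_step // dformDl o // add0r.
Qed.

Lemma gam_low i : (0 < i < K)%N -> '[lowpi, gam i] = 0.
Proof. by move=> /andP[i0 iK]; have [o _] := gam_extremal iK;
  rewrite -chain_head o. Qed.

Lemma gam_neq i j : (i < j)%N -> (j < K)%N -> gam i != gam j.
Proof.
move=> ij jK; have jr := simple_root (gam_simple jK); apply/eqP => E.
move: ij; rewrite leq_eqVlt => /predU1P[ij|ij]; last first.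
  by have := dform_root_gt0 jr; rewrite -{1}E gam_orth // ltxx.
have iK : (i < K)%N by apply: ltn_trans jK; rewrite -ij.
have [_] := gam_extremal iK; have [o _] := gam_extremal jK.
by rewrite E o -?ij // eqxx.
Qed.

Lemma gam_inj i j : (i < K)%N -> (j < K)%N -> gam i = gam j -> i = j.
Proof.
move=> iK jK E; case: (ltngtP i j) => // ij.
  by have := gam_neq ij jK; rewrite E eqxx.
by have := gam_neq ij iK; rewrite E eqxx.
Qed.

(** Also defined at the end of the path, where it is [walpha + alpha]. *)
Definition path_weight i := lowpi + \sum_(k < i) gam k.

Lemma path_weight_chain i : (i < K)%N -> x i = path_weight i.
Proof.
elim: i => [|i IH] iK; first by rewrite chain_head /path_weight big_ord0 addr0.
by rewrite -gam_step // IH ?(ltn_trans (ltnSn i)) // /path_weight big_ord_recr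
  addrA.
Qed.

Lemma path_weight_last : walpha + alpha = path_weight K.
Proof.
have K0 := size_chain_gt0;
  have -> : path_weight K = path_weight K.-1.+1 by rewrite prednK.
rewrite /path_weight big_ord_recr /= gam_last addrA -/(path_weight K.-1).
by rewrite -chain_last path_weight_chain ?prednK.
Qed.

Lemma coef_path_weight i beta : beta \in Psi -> (i <= K)%N ->
  coef (path_weight i) beta = (beta \in [seq gam k | k <- iota 0 i])%:R.
Proof.
move=> bP; elim: i => [|i IH] iK.
  by rewrite /path_weight big_ord0 addr0 /coef subrr zero_lfunE.
have -> : iota 0 i.+1 = iota 0 i ++ [:: i] by rewrite -[i.+1]addn1 iotaD.
rewrite /path_weight big_ord_recr addrA /= -/(path_weight i) coefD IH 1?ltnW //.
rewrite coweightE ?free_simple ?gam_simple // map_cat mem_cat /= inE.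
have [E|_] := eqVneq (gam i) beta; last by rewrite addr0 orbF.
rewrite -E orbT; case: mapP => [[k]|_]; last by rewrite add0r.
rewrite mem_iota /= => ki /(gam_inj iK);
  rewrite (ltn_trans ki iK) => /(_ isT) ik.
by rewrite ik ltnn in ki.
Qed.

Hypothesis alpha_Theta : alpha \in Theta.

(** A lowest vector of weight [x i] can only be lowered by [gam i.-1], since the
    only weight just below [x i] is [x i.-1]. A vector killed by [Theta] that is
    also killed by [gam i.-1] would have weight [lowpi]. *)
Lemma lowest_chain_step i : (0 < i < K)%N ->
  lowest_weights_Theta pi Psi Theta (x i) ->
  gam i.-1 \notin Theta.
Proof.
move=> /andP[i0 iK] /lowest_Theta_vector[v [v0 vm vk]]; apply/negP => gT.
have ni : x i != lowpi by rewrite -chain_head eq_sym;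
  have [] := @chain_lt 0 i; rewrite ?i0.
have [beta [X [bP Xb Xv]]] := descent v0 vm ni.
have wb : weights pi (x i - beta) by exists (pi X v) => //; apply: weight_act.
have [_ E] := below_chain_simple wb bP iK (subrK _ _).
have bE : beta = gam i.-1.
  by rewrite -(addKr (x i.-1) (gam i.-1)) gam_step ?prednK // -E opprB subrK.
by move: Xv; rewrite (vk (gam i.-1)) ?eqxx // -bE.
Qed.

Lemma chain_difference i : (i.+1 < K)%N ->
  (walpha - x i) (coweight Psi (gam i)) = 1.
Proof.
move=> iK; have K0 := size_chain_gt0.
have gP : gam i \in Psi by apply: gam_simple; apply: ltn_trans iK.
have -> : walpha - x i = (path_weight K.-1 - lowpi) - (path_weight i - lowpi).
  rewrite -path_weight_chain ?prednK // -path_weight_chain ?(ltn_trans _ iK) //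
    chain_last.
  by rewrite opprB addrA subrK.
rewrite add_lfunE opp_lfunE -!/(coef _ _) !coef_path_weight ?leq_pred ?(ltnW
  (ltn_trans _ iK)) //.
rewrite map_f ?mem_iota ?ltn_predRL //; case: mapP => [[k]|_];
  last by rewrite subr0.
rewrite mem_iota /= => ki /gam_inj E.
have ik : i = k by apply: E; rewrite ?(ltn_trans ki) // (ltn_trans _ iK).
by rewrite ik ltnn in ki.
Qed.

Lemma gammas_gam : gammas alpha w = [seq gam i | i <- iota 0 K].
Proof.
have K0 := size_chain_gt0;
  rewrite -[in RHS](prednK K0) -addn1 iotaD map_cat /= add0n gam_last.
rewrite /gammas cats1; congr rcons; rewrite /gammas' (iotaDl 1 0) -map_comp.
apply/eq_in_map => i; rewrite mem_iota /= => iK; rewrite ?add1n /wt /=.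
have iK1 : (i.+1 < K)%N by rewrite -ltn_predRL.
by rewrite -(gam_step iK1) addrAC subrr add0r.
Qed.

Lemma gammas'_gam i : (i.+1 < K)%N -> gam i \in gammas' w.
Proof.
move=> iK; apply/mapP; exists i.+1;
  first by rewrite mem_iota /= add1n ltnS -ltn_predRL in iK *.
by rewrite /wt /= -(@gam_step i) // addrAC subrr add0r.
Qed.

Lemma mem_gammas beta :
  (beta \in gammas alpha w) <-> exists2 i, (i < K)%N & beta = gam i.
Proof.
rewrite gammas_gam; split=> [/mapP[k]|[i iK ->]];
  first by rewrite mem_iota => kK ->; exists k.
by rewrite map_f // mem_iota.
Qed.

Lemma lowpi_le_chain : wle lowpi walpha.
Proof. by have [_] := chain_weight size_chain_gt0; rewrite chain_head. Qed.

(** * Lowest weights of the Levi part in the level of walpha + alpha *)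

(** Throughout, [v] is a lowest weight vector for [Theta] whose weight [mu] agrees
    with [walpha + alpha] outside [Theta]. The set [B] is the component of
    [alpha] in the Dynkin diagram of [Theta]. *)
Section SameLevel.
Variables (mu : dual ha) (v : V).
Hypotheses (v0 : v != 0) (vm : weight_vector pi mu v).
Hypothesis vTheta : forall beta, beta \in Theta -> killed_by beta v.
Hypothesis level : forall beta, beta \in Psi -> beta \notin Theta ->
  coef mu beta = coef (walpha + alpha) beta.

Lemma level_gam i : (i < K)%N -> gam i \notin Theta -> coef mu (gam i) = 1.
Proof.
move=> iK gT; rewrite level ?gam_simple // path_weight_last coef_path_weight
  ?gam_simple //.
by rewrite map_f // mem_iota.
Qed.

Lemma level_other beta : beta \in Psi -> beta \notin Theta ->
  (forall i, (i < K)%N -> beta <> gam i) -> coef mu beta = 0.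
Proof.
move=> bP bT bg; rewrite level // path_weight_last coef_path_weight //.
by case: mapP => // -[k]; rewrite mem_iota => kK /bg.
Qed.

(** A simple root that lowers [v] is not in [Theta] and occurs in [mu - lowpi],
    hence in the path; it is not [alpha], the last root of the path. *)
Lemma lowering_index beta X : beta \in Psi -> root_vector (- beta) X ->
  pi X v != 0 ->
  exists m, [/\ (m.+1 < K)%N, beta = gam m & gam m \notin Theta].
Proof.
move=> bP Xb Xv; have bT : beta \notin Theta.
  by apply/negP => bT; move: Xv; rewrite (vTheta bT Xb) eqxx.
have [m mK bE] : exists2 m, (m < K)%N & beta = gam m.
  apply: contrapT => /forall2NP nm; move: Xv;
    rewrite (coef0_killed vm bP) ?eqxx //.
  by apply: level_other => // i iK bE; case: (nm i).
exists m; rewrite -bE; split=> //; rewrite -ltn_predRL ltn_neqAle -ltnS.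
rewrite prednK ?size_chain_gt0 // mK andbT; apply: contraNneq bT => mE.
by rewrite bE mE gam_last.
Qed.

(** Here nothing can lower [v]. *)
Lemma level_inside_lowpi : (forall i, (i < K)%N -> gam i \in Theta) ->
  mu = lowpi.
Proof.
move=> gT; apply: contrapT => /eqP /(descent v0 vm)[beta [X [bP Xb Xv]]].
have [m [mK _]] := lowering_index bP Xb Xv.
by rewrite gT // ltnW.
Qed.

Variable B : set (dual ha).
Hypothesis B_Theta : forall beta, B beta -> beta \in Theta.
Hypothesis B_alpha : B alpha.
Hypothesis B_closed : forall beta delta, B beta -> delta \in Theta ->
  ~ B delta -> '[delta, beta] = 0.
Hypothesis B_low : forall beta, B beta -> '[beta, lowpi] = 0.
Hypothesis orth_Theta : forall beta i, beta \in Theta ->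
  (forall j, (j < K)%N -> beta <> gam j) -> (i.+1 < K)%N -> '[beta, gam i] = 0.

(** After [gam m], whose coefficient is 1, has been removed, the roots of the path
    above [m] together with the rest of [B] are orthogonal to [lowpi] and to all
    other roots in the support, so [support_connected] applies. *)
Lemma coef0_above m i : (m < K)%N -> gam m \notin Theta ->
  weights pi (mu - gam m) ->
  (m < i < K)%N -> coef mu (gam i) = 0.
Proof.
move=> mK mT wm /andP[mi iK].
pose A : pred (dual ha) := fun b =>
  `[< exists2 k, (m < k < K)%N & b = gam k >] ||
  `[< B b /\ forall k, (k < K)%N -> b <> gam k >].
have gP := gam_simple; have mP := gP _ mK; have iP := gP _ iK.
have Ai : A (gam i) by apply/orP; left; apply/asboolP; exists i; rewrite ?mi.
have coefm : coef (mu - gam m) (gam i) = coef mu (gam i).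
  by rewrite coef_sub // (negPf (gam_neq mi iK)) subr0.
rewrite -coefm; apply: (support_connected (A := A) wm) => // [b bP|b d bP dP].
  move=> /orP[/asboolP[k /andP[mk kK] ->]|/asboolP[Bb _]];
    last by rewrite dformC B_low.
  by apply: gam_low; rewrite kK (leq_ltn_trans _ mk).
move=> Ab nAd cd.
have [[k kK d_gam]|ndg] := pselect (exists2 k, (k < K)%N & d = gam k).
  have km : (k < m)%N.
    rewrite ltn_neqAle; apply/andP; split.
      apply: contraNneq cd => km;
        rewrite coef_sub // d_gam km eqxx level_gam //.
      by rewrite subrr.
    rewrite leqNgt; apply: contra nAd => mk; apply/orP; left; apply/asboolP.
    by exists k; rewrite ?mk.
  rewrite d_gam; move: Ab => /orP[/asboolP[l /andP[ml lK] ->]|/asboolP[Bb bg]].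
    by apply: gam_orth => //; apply: leq_ltn_trans ml.
  by rewrite dformC orth_Theta ?(leq_ltn_trans km) //; apply: B_Theta.
have dg k : (k < K)%N -> d <> gam k by move=> kK d_gam; apply: ndg; exists k.
have dT : d \in Theta.
  apply: contraNT cd => dT; rewrite coef_sub // level_other // sub0r oppr_eq0.
  by have [E|_] := eqVneq (gam m) d; [case: (dg _ mK)|rewrite eqxx].
have nBd : ~ B d by move=> Bd; move/negP: nAd; apply; apply/orP; right;
  apply/asboolP.
move: Ab => /orP[/asboolP[l /andP[ml lK] ->]|/asboolP[Bb bg]];
  last exact: B_closed.
have [lK1|] := ltnP l.+1 K; first exact: orth_Theta.
rewrite leq_eqVlt ltnS leqNgt lK orbF => /eqP Kl.
have -> : gam l = alpha by rewrite -gam_last Kl.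
exact: B_closed.
Qed.

Hypothesis serre : forall i, (i.+2 < K)%N ->
  cint (gam i) (gam i.+1) = -1 /\ cint (gam i.+1) (gam i) = -1.

(** The state reached after lowering [v] by [gam m], ..., [gam j.+1]: [gam j] is the
    only simple root that can still lower [u], the double lowerings allowed by
    the Serre relations vanish, and the support stays in [Theta] and the path. *)
Definition descending j nu (u : V) :=
  [/\ u != 0, weight_vector pi nu u, nu != lowpi &
  [/\ forall beta, beta \in Psi -> beta != gam j -> killed_by beta u,
      forall Y Z, root_vector (- gam j) Y -> root_vector (- gam j) Z ->
        pi Z (pi Y u) = 0,
      forall Y Z, (j.+1 < K)%N -> root_vector (- gam j) Y ->
        root_vector (- gam j.+1) Z ->
        pi Z (pi Y u) = 0 &
      forall beta, beta \in Psi -> beta \notin Theta ->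
        (forall i, (i < K)%N -> beta <> gam i) -> coef nu beta = 0]].

(** A simple root at distance at least 2 from [gam j] commutes with it, and the two
    neighbouring cases are part of the state. *)
Lemma descending_lower j nu u : (j.+1 < K)%N -> descending j nu u ->
  exists Y, [/\ root_vector (- gam j) Y, pi Y u != 0,
    weight_vector pi (nu - gam j) (pi Y u) &
    forall beta, beta \in Psi -> (forall i, j = i.+1 -> beta <> gam i) ->
    killed_by beta (pi Y u)].
Proof.
move=> jK [u0 um nl [uk uS uT uW]];
  have jP : gam j \in Psi by apply/gam_simple/ltnW.
have [b [Y [bP Yb Yu]]] := descent u0 um nl.
have bE : b = gam j.
  by apply/eqP; apply: contraNT Yu => bj; rewrite (uk b bP bj _ Yb).
rewrite bE in Yb; have ym : weight_vector pi (nu - gam j) (pi Y u)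
  by apply: weight_act.
exists Y; split=> // d dP dj Z Zd.
have [d_gam|dj0] := eqVneq d (gam j); first by rewrite d_gam in Zd; apply: uS.
have comm : '[d, gam j] = 0 -> pi Z (pi Y u) = 0.
  by move=> dg; rewrite (orth_commute _ dP jP dg Zd Yb) (uk d dP dj0 _ Zd)
    linear0.
have [[i iK d_gam]|dg] := pselect (exists2 i, (i < K)%N & d = gam i).
  rewrite d_gam in Zd dj dj0 comm; case: (ltngtP i j) => ij.
  - case: (ltngtP i.+1 j) => ij1; last by case: (dj i).
      by apply: comm; apply: gam_orth => //; apply: ltnW.
    by rewrite ltnNge ij in ij1.
  - case: (ltngtP j.+1 i) => ij1.
    + by apply: comm; rewrite dformC gam_orth.
    + by rewrite ltnNge ij in ij1.
    + by apply: uT => //; rewrite ij1.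
  - by rewrite ij eqxx in dj0.
have {}dg i : (i < K)%N -> d <> gam i by move=> iK d_gam; apply: dg; exists i.
have [dT|dT] := boolP (d \in Theta); first exact/comm/orth_Theta.
apply: (coef0_killed ym dP) Zd; rewrite coef_sub // uW // sub0r.
by case: eqP => [E|_]; [case: (dg _ (ltnW jK)); rewrite E|rewrite oppr0].
Qed.

(** For [Y] of weight [- gam j.+1] and [X] of weight [- gam j], the vector [u] is
    killed by [X] and by [Y Y], so the Serre relations give
    [[X', [X, Y]] u = X' X Y u] and [[Y, [Y, X]] u = - 2 Y X Y u]. *)
Lemma descending_step j nu u : (j.+2 < K)%N -> descending j.+1 nu u ->
  exists u', descending j (nu - gam j.+1) u'.
Proof.
move=> jK ds; have [Y [Yb Yu ym yk]] := descending_lower jK ds.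
have [u0 um nl [uk uS uT uW]] := ds.
have jK1 : (j.+1 < K)%N by apply: ltnW.
have jP := gam_simple jK1; have iP := gam_simple (ltnW jK1).
have ij : gam j != gam j.+1 by apply: gam_neq.
have [c1 c2] := serre jK.
exists (pi Y u); split=> //.
  (* If lowering led to lowpi, then lowpi + gam j.+1 would be a weight, although
     gam j.+1 is orthogonal to lowpi. *)
  apply/eqP => E; have wn : weights pi nu by exists u.
  have nE : nu = lowpi + gam j.+1 by rewrite -E subrK.
  have jr := simple_root jP.
  have cn : cint nu (gam j.+1) = 2%:R.
    by rewrite nE cintD cint_root // /cint gam_low ?jK1 // mulr0 mul0r add0r.
  have := string_down hpi wn jr cn (leqnn 2); rewrite nE => /(coef_pos jP)[m].
  rewrite coefD /coef subrr zero_lfunE add0r coweightE ?free_simple // eqxx.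
  by move=> /eqP; rewrite -[1]/(1%:R) eqr_nat.
split.
- by move=> b bP bj; apply: yk => // i [<-]; apply/eqP.
- move=> X X' Xb X'b; rewrite [pi X _]rep_comm // (uk _ iP ij _ Xb) linear0
    add0r.
  rewrite rep_comm // (uk _ iP ij _ X'b) linear0 add0r.
  exact: (serre_vanish _ jP iP c2).
- move=> X Z _ Xb Zb; have Y0 : Y != 0.
    by apply: contraNneq Yu => ->; rewrite linear0 zero_lfunE.
  have [c ->] := root_space_dim1 (roots_opp (simple_root jP)) Yb Y0 Zb.
  rewrite linearZ scale_lfunE;
    suff -> : pi Y (pi X (pi Y u)) = 0 by rewrite scaler0.
  have br T U z : pi (lieb T U) z = pi T (pi U z) - pi U (pi T z).
    by rewrite (rep_comm hpi T U) addrAC subrr add0r.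
  have := serre_vanish u iP jP c1 Yb Yb Xb.
  rewrite !br (uk _ iP ij _ Xb) (uS _ _ Yb Yb) !linear0.
  rewrite sub0r addr0 linearN /=.
  move=> /eqP; rewrite -opprD oppr_eq0 -mulr2n -scaler_nat scaler_eq0 pnatr_eq0.
  by move=> /eqP.
- by move=> b bP bT bg; rewrite coef_sub // uW //; case: eqP => [E|_];
    [case: (bg _ jK1); rewrite E|rewrite subr0].
Qed.

(** The vector can be lowered by [gam j], ..., [gam 0] in turn, and nothing
    lowers it afterwards: what has been removed is exactly [gam 0 + ... + gam j]. *)
Lemma descending_path_weight j nu u : (j.+1 < K)%N -> descending j nu u ->
  nu = path_weight j.+1.
Proof.
elim: j nu u => [|j IH] nu u jK ds.
  have [Y [Yb Yu ym yk]] := descending_lower jK ds.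
  have E : nu - gam 0 = lowpi by apply: (killed_by_simple_lowpi Yu ym) =>
    b bP; apply: yk.
  by rewrite /path_weight big_ord_recr big_ord0 /= add0r -E subrK.
have [u' /IH E] := descending_step jK ds.
by rewrite /path_weight big_ord_recr addrA /= -/(path_weight j.+1) -E ?subrK //
  ltnW.
Qed.

(** Let [gam m] be a root that lowers [v]. By [coef0_above] the path roots above [m]
    do not occur in [mu - lowpi], and this characterizes [m]; then [v] is in the
    state [descending m mu], and [mu = x m.+1]. *)
Lemma type_A_level_below : wle mu walpha.
Proof.
have [->|ml] := eqVneq mu lowpi; first exact: lowpi_le_chain.
have [b [X [bP Xb Xv]]] := descent v0 vm ml.
have [m [mK bE mT]] := lowering_index bP Xb Xv; rewrite bE in bP Xb => {b bE}.
have wm : weights pi (mu - gam m) by exists (pi X v) => //; apply: weight_act.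
have cm : coef mu (gam m) = 1 by apply: level_gam => //; apply: ltnW.
have above i : (m < i < K)%N -> coef mu (gam i) = 0 by apply: coef0_above =>
  //; apply: ltnW.
suff /descending_path_weight E : descending m mu v.
  by rewrite E // -path_weight_chain //; have [] := chain_weight mK.
split=> //; split.
- move=> d dP dm Y Yd; apply: contrapT => /eqP Yv.
  have [k [kK d_gam kT]] := lowering_index dP Yd Yv; rewrite d_gam in dm.
  have ck : coef mu (gam k) = 1 by apply: level_gam => //; apply: ltnW.
  (* Of two different roots that lower v, the later one would have both
     coefficient 1 and coefficient 0. *)
  case: (ltngtP k m) => km.
  + have wk : weights pi (mu - gam k).
      by exists (pi Y v) => //; apply: weight_act; rewrite // -d_gam.
    have := coef0_above (ltnW kK) kT wk; move=> /(_ m);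
      rewrite km (ltnW mK) cm => /(_ isT)/eqP.
    by rewrite oner_eq0.
  + by have := above k; rewrite km (ltnW kK) ck => /(_ isT)/eqP;
      rewrite oner_eq0.
  + by rewrite km eqxx in dm.
- move=> Y Z Yb Zb; have ym := weight_act hpi Yb vm.
  by apply: (coef0_killed ym bP) Zb; rewrite coef_sub // eqxx cm subrr.
- move=> Y Z m1K Yb Zb; have ym := weight_act hpi Yb vm.
  apply: (coef0_killed ym (gam_simple m1K)) Zb.
  by rewrite (coef_sub _ (gam_simple m1K) bP) (negPf (gam_neq (ltnSn m) m1K))
    above ?ltnSn ?subr0.
- exact: level_other.
Qed.
End SameLevel.

Lemma chain_inside_level mu : lowest_weights_Theta pi Psi Theta mu ->
  (forall beta, beta \in Psi -> beta \notin Theta ->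
    coef mu beta = coef (walpha + alpha) beta) ->
  (forall i, (i < K)%N -> gam i \in Theta) -> wle mu walpha.
Proof.
move=> /lowest_Theta_vector[v [v0 vm vk]] lv gT.
by rewrite (level_inside_lowpi v0 vm vk lv gT); apply: lowpi_le_chain.
Qed.

(** In a diagram of type A adjacency determines the Cartan integers, whatever the
    numbering that exhibits the type. *)
Lemma type_A_serre i : dynkin_type_A pi K.-1 (gammas' w) -> (i.+2 < K)%N ->
  cint (gam i) (gam i.+1) = -1 /\ cint (gam i.+1) (gam i) = -1.
Proof.
move=> [t [ut st tE cE]] iK; have iK1 : (i.+1 < K)%N by apply: ltnW.
have it : gam i \in t by rewrite tE gammas'_gam.
have jt : gam i.+1 \in t by rewrite tE gammas'_gam.
have ij : gam i != gam i.+1 by apply: gam_neq.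
have adj := gam_adj iK1.
have key b d : b \in t -> d \in t -> b != d -> '[b, d] != 0 -> roots d ->
  cint b d = -1.
  move=> bt dt bd nz dr; have := cE (index b t) (index d t).
  rewrite -st !index_mem bt dt !nth_index // => /(_ isT isT) E.
  have ib : (index b t == index d t) = false.
    by apply/negP => /eqP /(congr1 (nth 0 t)); rewrite !nth_index // => /eqP;
      rewrite (negPf bd).
  move: E; rewrite ib; case: ifP => // _ c0; move: nz.
  by rewrite -(cint_eq0 _ dr) /cint c0 eqxx.
have r1 := simple_root (gam_simple iK1).
have r0 := simple_root (gam_simple (ltnW iK1)).
have ji : gam i.+1 != gam i by rewrite eq_sym.
by split; first exact: key; apply: key => //; rewrite dformC.
Qed.

Lemma chain_type_A_level mu (B : set (dual ha)) :
  lowest_weights_Theta pi Psi Theta mu ->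
  (forall beta, beta \in Psi -> beta \notin Theta ->
    coef mu beta = coef (walpha + alpha) beta) ->
  (forall beta, B beta -> beta \in Theta) -> B alpha ->
  (forall beta delta, B beta -> delta \in Theta -> ~ B delta ->
    '[delta, beta] = 0) ->
  (forall beta, B beta -> '[beta, lowpi] = 0) ->
  (forall beta gam, beta \in Theta -> beta \notin gammas alpha w ->
            gam \in gammas' w -> '[beta, gam] = 0) ->
  dynkin_type_A pi K.-1 (gammas' w) -> wle mu walpha.
Proof.
move=> /lowest_Theta_vector[v [v0 vm vk]] lv BT Ba Bc Bl orth tA.
apply: (type_A_level_below v0 vm vk lv BT Ba Bc Bl) => [b i bT bg iK|i].
  apply: orth (gammas'_gam iK) => //; apply/negP => /mem_gammas[j jK].
  exact: bg.
exact: type_A_serre.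
Qed.

Lemma component_closed (B := dynkin_component pi [` alpha_Theta]%fset) :
  [/\ forall beta, B beta -> beta \in Theta, B alpha &
   forall beta delta, B beta -> delta \in Theta -> ~ B delta ->
     '[delta, beta] = 0].
Proof.
split=> [_ [y _ <-]||_ delta [y yc <-] dT nB]; first exact: (valP y).
  by exists [` alpha_Theta]%fset => //=; apply: connect0.
apply: contrapT => /eqP nz; apply: nB; exists [` dT]%fset => //=.
have [yd|yd] := eqVneq y [` dT]%fset; first by rewrite -yd.
apply: (connect_trans yc); apply: connect1;
  rewrite /dynkin_adj /= dformC nz andbT.
by apply: contra yd => /eqP E; apply/eqP/val_inj.
Qed.

(** * Non-vanishing of the product *)

Variable n : seq nat.
Hypothesis hn : chain_indices pi Psi Theta walpha w n.
Hypothesis below : forall mu, lowest_weights_Theta pi Psi Theta mu ->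
  (forall beta, beta \in Psi -> beta \notin Theta ->
     coef mu beta = coef (walpha + alpha) beta) ->
  wle mu walpha.

Lemma finite_Omega : finite_set (Omega pi Psi (Theta := Theta) lowpi).
Proof.
apply: finite_image; apply: (@sub_finite_set _ _ (@weights _ _ a _ pi));
  last exact: finite_weights.
by move=> mu /lowest_Theta_vector[v [v0 vm _]]; exists v.
Qed.

(** If the linear part vanishes, the weight agrees with [walpha + alpha] on
    [a_Theta], hence is below [walpha] by assumption: its pair lies in
    [Omega_below]. *)
Lemma Omega_factor p :
  (Omega pi Psi (Theta := Theta) lowpi `\`
   Omega_below pi Psi (Theta := Theta) lowpi walpha) p ->
  nonconstant_affine (fun lam : dual_Theta Theta =>
    '[ext_Theta pi lam, walpha + alpha] - p.1 lam
     + D_pi pi Psi lowpi (walpha + alpha) - p.2).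
Proof.
move=> [[mu muT <-] nb] /=.
apply: (@ext_form_affine (walpha + alpha - mu) _ _
  (D_pi pi Psi lowpi (walpha + alpha) - D_pi pi Psi lowpi mu)) => [|lam];
    last first.
  by rewrite dformDr dformNr res_ThetaE addrA.
apply: contrapT => /forallNP nz; apply: nb; exists mu => //; split=> //.
apply: below => // beta bP bT; apply/esym;
  apply: (res_Theta_coef _ bP bT) => lam.
by apply: contrapT => /eqP /nz.
Qed.

(** The coefficient of [gam k.-1], a simple root outside [Theta], in
    [walpha - x k.-1] is 1. *)
Lemma chain_factor j : (1 <= j < size n)%N ->
  nonconstant_affine (fun lam : dual_Theta Theta =>
    '[ext_Theta pi lam, walpha - wt w (nth 0%N n j)] - '[alpha, walpha]
     + D_pi pi Psi lowpi walpha - D_pi pi Psi lowpi (wt w (nth 0%N n j).+1)).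
Proof.
move=> /andP[j0 jn]; set k := nth 0%N n j; have [n0 ns nK nE] := hn.
have k0 : (0 < k)%N.
  rewrite /k; case: (n) n0 ns jn => // m n' [->] /= pn;
    case: (j) j0 => // j' _ jn.
  by have /allP := order_path_min ltn_trans pn; apply; apply: mem_nth.
have kK : (k < K)%N by move/allP: nK; apply; apply: mem_nth.
have kT : gam k.-1 \notin Theta.
  apply: lowest_chain_step; first by rewrite k0.
  have [s1 _] := (seteqP _ _).1 nE.
  have : x k \in [seq wt w k.+1 | k <- n] by apply/mapP; exists k => //;
    apply: mem_nth.
  by move/s1 => [].
have kK1 : (k.-1.+1 < K)%N by rewrite prednK.
have gP : gam k.-1 \in Psi by apply/gam_simple/ltnW.
apply: (@ext_form_affine (walpha - x k.-1) _ _ (- '[alpha, walpha]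
  + D_pi pi Psi lowpi walpha - D_pi pi Psi lowpi (wt w k.+1))) => [|lam].
  2: by rewrite -!addrA.
have [lam lamE] := ext_Theta_eval (coweight_a_Theta gP kT).
by exists lam; rewrite lamE chain_difference // oner_eq0.
Qed.

Lemma r_fun_nonzero : exists lambda : dual_Theta Theta,
  r_fun pi Psi lowpi alpha walpha w n lambda != 0.
Proof.
set A := Omega pi Psi (Theta := Theta) lowpi `\` Omega_below pi Psi (Theta :=
  Theta) lowpi walpha.
have finA : finite_set A by apply: finite_setD; apply: finite_Omega.
pose f (t : (dual (dual_Theta Theta) * C) + nat) (lam : dual_Theta Theta) : C :=
  match t with
  | inl p => '[ext_Theta pi lam, walpha + alpha] - p.1 lam + D_pi pi Psi lowpi
    (walpha + alpha) - p.2
  | inr j => '[ext_Theta pi lam, walpha - wt w (nth 0%N n j)] - '[alpha, walpha]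
     + D_pi pi Psi lowpi walpha - D_pi pi Psi lowpi (wt w (nth 0%N n j).+1)
  end.
have [t|lam lamP] := @affine_common_nonzero C (dual_Theta Theta) _ f
  ([seq inl p | p <- fset_set A] ++ [seq inr j | j <- index_iota 1 (size n)]).
  rewrite mem_cat => /orP[/mapP[p pA ->]|/mapP[j]].
    by apply: Omega_factor; move: pA; rewrite in_fset_set // inE.
  by rewrite mem_index_iota => jn ->; apply: chain_factor.
exists lam; rewrite /r_fun mulf_neq0 //.
  rewrite fsbig_finite // prodf_seq_neq0; apply/allP => p pA /=.
  by apply: (lamP (inl p)); rewrite mem_cat map_f.
rewrite prodf_seq_neq0; apply/allP => j jn /=.
by apply: (lamP (inr j)); rewrite mem_cat map_f ?orbT.
Qed.

End Chain.

End Representation.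

Theorem proposition3p25 (R : realType) (g : lieAlgType R[i])
    (V : vectType R[i]) (pi : 'Hom(g, 'End(V))) (a : {vspace g})
    (Psi Theta : {fset dual (subvs_of a)})
    (lowpi alpha walpha : dual (subvs_of a))
    (w : seq (dual (subvs_of a))) (n : seq nat)
    (hg : reductive g)
    (hpi : lie_representation pi) (hfaith : faithful pi)
    (hirr : irreducible pi setT fullv)
    (ha : cartan_subalgebra a)
    (hPsi : simple_system Psi) (hTheta : (Theta `<` Psi)%fset)
    (hlow : lowest_weight pi (positive_roots Psi) fullv lowpi)
    (halpha : alpha \in Theta)
    (hwalpha : extremal_low_weight pi Psi alpha walpha)
    (hw : weight_chain pi Psi walpha w)
    (hn : chain_indices pi Psi Theta walpha w n)
    (hcond :
      (forall gam, gam \in gammas alpha w -> gam \in Theta) \/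
      [/\ forall beta, dynkin_component pi [` halpha]%fset beta ->
            dform pi beta lowpi = 0,
          forall beta gam, beta \in Theta -> beta \notin gammas alpha w ->
            gam \in gammas' w -> dform pi beta gam = 0 &
          dynkin_type_A pi (size w).-1 (gammas' w)]) :
  exists lambda : dual_Theta Theta,
    r_fun pi Psi lowpi alpha walpha w n lambda != 0.
Proof.
have sub : forall beta, beta \in Theta -> beta \in Psi.
  by apply/fsubsetP; apply: fproper_sub.
have aP := sub _ halpha.
apply: (r_fun_nonzero hpi hfaith hirr ha hPsi hlow sub aP hwalpha hw hn) =>
  mu muT lv.
case: hcond => [inT|[compl orth tA]].
  apply: (chain_inside_level hpi hfaith hirr ha hPsi hlow sub aP hwalpha hw
    halpha muT lv).
  move=> j jK; apply: inT.
  by apply/(mem_gammas hwalpha hw); exists j.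
have [BT Ba Bc] := component_closed pi halpha.
exact: (chain_type_A_level hpi hfaith hirr ha hPsi hlow sub aP hwalpha hw
  halpha muT lv BT Ba Bc compl orth tA).
Qed.
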